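(* Let $\mathbf{V}$ be a variety of Heyting algebras and let $\rho^*(\mathbf{V})$ be the variety of interior algebras generated by $\{\mathcal{B}(L): L\in\mathbf{V}\}$. If $\rho^*(\mathbf{V})$ is locally finite, then $t(\mathbf{V}) = t(\rho^*(\mathbf{V}))$.
   Context: An interior algebra is a Boolean algebra with an operator $g$ satisfying $g(1)=1$, $g(x\cdot y)=g(x)\cdot g(y)$, $g(x)\le x$, $g(g(x))=g(x)$. For a Heyting algebra $L$, $\mathcal{B}(L)=\langle \mathrm{Fr}(L), g_L\rangle$ where $\mathrm{Fr}(L)$ is the free Boolean extension of $L$ and $g_L((-u_1+v_1)\cdots(-u_n+v_n)) = (u_1\Rightarrow v_1)\cdots(u_n\Rightarrow v_n)$ for $u_i,v_i\in L$. Unification: for a variety $\mathbf{W}$ and finitely presented $A\in\mathbf{W}$, a unifier is a pair $\langle u,B\rangle$ with $B$ finitely presented and projective in $\mathbf{W}$ and $u\colon A\to B$ a homomorphism; $A$ is unifiable if it has a unifier. Unifiers are quasiordered by $\langle u,B\rangle\succcurlyeq\langle v,C\rangle$ iff $v=h\circ u$ for some homomorphism $h\colon B\to C$. The type of $A$ is $1$, $\omega$, $\infty$ according as the quasiordered set of unifiers has a dense antichain ($\mu$-set) of cardinality $1$, finite $>1$, or infinite, and $0$ if it has no $\mu$-set. The type $t(\mathbf{W})$ of the variety is unitary if every unifiable algebra has type $1$; finitary if all have type $1$ or $\omega$ and some has type $\omega$; infinitary if all have type $1,\omega,\infty$ and some has type $\infty$; nullary if some algebra has type $0$ (equivalently the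 maximum of the types w.r.t. $1<\omega<\infty<0$). *)

(* Defs.v *)
From mathcomp Require Import all_boot.
From Stdlib Require List.

Set Implicit Arguments.
Unset Strict Implicit.
Unset Printing Implicit Defensive.

Record signature := Signature { op_sym : Type; arity : op_sym -> nat }.

Section UniversalAlgebra.
Variable sig : signature.

Record algebra := Algebra {
  carrier :> Type;
  interp : forall o : op_sym sig, ('I_(arity o) -> carrier) -> carrier }.
Arguments interp : clear implicits.

Inductive term (X : Type) : Type :=
| Var : X -> term X
| App : forall o : op_sym sig, ('I_(arity o) -> term X) -> term X.

Fixpoint eval (A : algebra) (X : Type) (v : X -> A) (t : term X) : A :=
  match t with
  | Var x => v x
  | App o ts => interp A o (fun i => eval v (ts i))
  end.

Definition equation := (term nat * term nat)%type.

Definition satisfies (A : algebra) (e : equation) : Prop :=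
  forall v : nat -> A, eval v e.1 = eval v e.2.

Definition Mod (E : equation -> Prop) (A : algebra) : Prop :=
  forall e, E e -> satisfies A e.

Definition is_hom (A B : algebra) (f : A -> B) : Prop :=
  forall o (args : 'I_(arity o) -> A),
    f (interp A o args) = interp B o (fun i => f (args i)).

Definition surj (T U : Type) (f : T -> U) : Prop := forall y, exists x, f x = y.

Definition is_finite (T : Type) : Prop := exists s : list T, forall x, List.In x s.

Definition generated_by (A : algebra) (X : Type) (a : X -> A) : Prop :=
  forall x : A, exists t : term X, eval a t = x.

Definition fin_generated (A : algebra) : Prop :=
  exists (X : Type) (a : X -> A), is_finite X /\ generated_by a.

Definition locally_finite (W : algebra -> Prop) : Prop :=
  forall A, W A -> fin_generated A -> is_finite A.

Definition fin_presented (W : algebra -> Prop) (A : algebra) : Prop :=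
  W A /\
  exists (X : Type) (a : X -> A) (R : list (term X * term X)),
    [/\ is_finite X, generated_by a,
        (forall p, List.In p R -> eval a p.1 = eval a p.2) &
        (forall B, W B -> forall b : X -> B,
            (forall p, List.In p R -> eval b p.1 = eval b p.2) ->
            exists h : A -> B, is_hom h /\ forall x, h (a x) = b x)].

Definition projective (W : algebra -> Prop) (B : algebra) : Prop :=
  W B /\
  forall (A C : algebra), W A -> W C ->
  forall f : A -> C, is_hom f -> surj f ->
  forall g : B -> C, is_hom g ->
  exists h : B -> A, is_hom h /\ forall x, f (h x) = g x.

Record unifier (W : algebra -> Prop) (A : algebra) := Unifier {
  u_alg : algebra;
  u_map : A -> u_alg;
  u_hom : is_hom u_map;
  u_fp : fin_presented W u_alg;
  u_proj : projective W u_alg }.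

Definition more_general (W : algebra -> Prop) (A : algebra)
  (U V : unifier W A) : Prop :=
  exists h : u_alg U -> u_alg V, is_hom h /\ forall x, u_map V x = h (u_map U x).

Definition unifiable (W : algebra -> Prop) (A : algebra) : Prop :=
  inhabited (unifier W A).

Definition mu_set (W : algebra -> Prop) (A : algebra) (I : Type)
  (M : I -> unifier W A) : Prop :=
  (forall U : unifier W A, exists i, more_general (M i) U) /\
  (forall i j, i <> j -> ~ more_general (M i) (M j)).

Definition has_type_1 (W : algebra -> Prop) (A : algebra) : Prop :=
  exists (I : Type) (M : I -> unifier W A),
    mu_set M /\ exists i0 : I, forall i, i = i0.

Definition has_type_omega (W : algebra -> Prop) (A : algebra) : Prop :=
  exists (I : Type) (M : I -> unifier W A),
    [/\ mu_set M, is_finite I & exists i j : I, i <> j].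

Definition has_type_infty (W : algebra -> Prop) (A : algebra) : Prop :=
  exists (I : Type) (M : I -> unifier W A), mu_set M /\ ~ is_finite I.

Definition has_type_0 (W : algebra -> Prop) (A : algebra) : Prop :=
  ~ exists (I : Type) (M : I -> unifier W A), mu_set M.

Inductive unif_type := Unitary | Finitary | Infinitary | Nullary.

Definition variety_type (W : algebra -> Prop) (k : unif_type) : Prop :=
  match k with
  | Unitary =>
      forall A, fin_presented W A -> unifiable W A -> has_type_1 W A
  | Finitary =>
      (forall A, fin_presented W A -> unifiable W A ->
         has_type_1 W A \/ has_type_omega W A) /\
      (exists A, [/\ fin_presented W A, unifiable W A & has_type_omega W A])
  | Infinitary =>
      (forall A, fin_presented W A -> unifiable W A ->
         [\/ has_type_1 W A, has_type_omega W A | has_type_infty W A]) /\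
      (exists A, [/\ fin_presented W A, unifiable W A & has_type_infty W A])
  | Nullary =>
      exists A, [/\ fin_presented W A, unifiable W A & has_type_0 W A]
  end.

End UniversalAlgebra.

Arguments interp {sig} a o _.
Arguments Var {sig X}.
Arguments App {sig X}.

Definition noargs (T : Type) (i : 'I_0) : T.
Proof. exfalso; case: i => m; by rewrite ltn0. Defined.

Definition args2 (T : Type) (x y : T) : 'I_2 -> T :=
  fun i => if nat_of_ord i == 0 then x else y.

Definition args1 (T : Type) (x : T) : 'I_1 -> T := fun _ => x.

Inductive hop := HMeet | HJoin | HImp | HBot | HTop.
Definition harity (o : hop) : nat :=
  match o with HMeet | HJoin | HImp => 2 | HBot | HTop => 0 end.
Definition HSig : signature := Signature harity.

Definition hmeet {X} (s t : term HSig X) : term HSig X := @App HSig X HMeet (args2 s t).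
Definition hjoin {X} (s t : term HSig X) : term HSig X := @App HSig X HJoin (args2 s t).
Definition himp {X} (s t : term HSig X) : term HSig X := @App HSig X HImp (args2 s t).
Definition hbot {X} : term HSig X := @App HSig X HBot (@noargs _).
Definition htop {X} : term HSig X := @App HSig X HTop (@noargs _).

Definition hx : term HSig nat := Var 0.
Definition hy : term HSig nat := Var 1.
Definition hz : term HSig nat := Var 2.

Definition HA_axioms (e : equation HSig) : Prop :=
  List.In e [::
    (hmeet hx hy, hmeet hy hx); (hjoin hx hy, hjoin hy hx);
    (hmeet hx (hmeet hy hz), hmeet (hmeet hx hy) hz);
    (hjoin hx (hjoin hy hz), hjoin (hjoin hx hy) hz);
    (hmeet hx (hjoin hx hy), hx); (hjoin hx (hmeet hx hy), hx);
    (hjoin hx hbot, hx); (hmeet hx htop, hx);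
    (himp hx hx, htop);
    (hmeet hx (himp hx hy), hmeet hx hy);
    (hmeet hy (himp hx hy), hy);
    (himp hx (hmeet hy hz), hmeet (himp hx hy) (himp hx hz))].

(* the variety of Heyting algebras axiomatized by HA_axioms + E; every
   variety of Heyting algebras is of this form (Birkhoff) *)
Definition HVariety (E : equation HSig -> Prop) : algebra HSig -> Prop :=
  Mod (fun e => HA_axioms e \/ E e).

Definition Hmeet (L : algebra HSig) (x y : L) : L := interp L HMeet (args2 x y).
Definition Hjoin (L : algebra HSig) (x y : L) : L := interp L HJoin (args2 x y).
Definition Himp (L : algebra HSig) (x y : L) : L := interp L HImp (args2 x y).
Definition Hbot (L : algebra HSig) : L := interp L HBot (@noargs _).
Definition Htop (L : algebra HSig) : L := interp L HTop (@noargs _).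

Inductive iop := IMeet | IJoin | ICompl | IBot | ITop | IInt.
Definition iarity (o : iop) : nat :=
  match o with IMeet | IJoin => 2 | ICompl | IInt => 1 | IBot | ITop => 0 end.
Definition ISig : signature := Signature iarity.

Definition imeet {X} (s t : term ISig X) : term ISig X := @App ISig X IMeet (args2 s t).
Definition ijoin {X} (s t : term ISig X) : term ISig X := @App ISig X IJoin (args2 s t).
Definition icompl {X} (s : term ISig X) : term ISig X := @App ISig X ICompl (args1 s).
Definition iint {X} (s : term ISig X) : term ISig X := @App ISig X IInt (args1 s).
Definition ibot {X} : term ISig X := @App ISig X IBot (@noargs _).
Definition itop {X} : term ISig X := @App ISig X ITop (@noargs _).

Definition ix : term ISig nat := Var 0.
Definition iy : term ISig nat := Var 1.
Definition iz : term ISig nat := Var 2.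

Definition IA_axioms (e : equation ISig) : Prop :=
  List.In e [::
    (imeet ix iy, imeet iy ix); (ijoin ix iy, ijoin iy ix);
    (imeet ix (imeet iy iz), imeet (imeet ix iy) iz);
    (ijoin ix (ijoin iy iz), ijoin (ijoin ix iy) iz);
    (imeet ix (ijoin ix iy), ix); (ijoin ix (imeet ix iy), ix);
    (imeet ix (ijoin iy iz), ijoin (imeet ix iy) (imeet ix iz));
    (ijoin ix ibot, ix); (imeet ix itop, ix);
    (imeet ix (icompl ix), ibot); (ijoin ix (icompl ix), itop);
    (iint itop, itop);
    (iint (imeet ix iy), imeet (iint ix) (iint iy));
    (imeet (iint ix) ix, iint ix);
    (iint (iint ix), iint ix)].

Definition Imeet (A : algebra ISig) (x y : A) : A := interp A IMeet (args2 x y).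
Definition Ijoin (A : algebra ISig) (x y : A) : A := interp A IJoin (args2 x y).
Definition Icompl (A : algebra ISig) (x : A) : A := interp A ICompl (args1 x).
Definition Iint (A : algebra ISig) (x : A) : A := interp A IInt (args1 x).
Definition Ibot (A : algebra ISig) : A := interp A IBot (@noargs _).
Definition Itop (A : algebra ISig) : A := interp A ITop (@noargs _).

Inductive bool_gen (A : algebra ISig) (S : A -> Prop) : A -> Prop :=
| bg_in x : S x -> bool_gen S x
| bg_meet x y : bool_gen S x -> bool_gen S y -> bool_gen S (Imeet x y)
| bg_join x y : bool_gen S x -> bool_gen S y -> bool_gen S (Ijoin x y)
| bg_compl x : bool_gen S x -> bool_gen S (Icompl x)
| bg_bot : bool_gen S (Ibot A)
| bg_top : bool_gen S (Itop A).

(* A is (an isomorphic copy of) B(L) = <Fr(L), g_L>: A is an interior algebra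
   whose Boolean reduct is the free Boolean extension of L, i.e. it contains
   L via a bounded-lattice embedding e whose image generates A as a Boolean
   algebra, and whose interior operator is
   g((-e u1 + e v1)...(-e un + e vn)) = e((u1 => v1)...(un => vn)). *)
Definition is_BL (L : algebra HSig) (A : algebra ISig) : Prop :=
  Mod IA_axioms A /\
  exists e : L -> A,
    [/\ injective e,
        (forall x y, e (Hmeet x y) = Imeet (e x) (e y) /\
                     e (Hjoin x y) = Ijoin (e x) (e y)),
        e (Hbot L) = Ibot A /\ e (Htop L) = Itop A,
        (forall a : A, bool_gen (fun b => exists x, e x = b) a) &
        (forall ps : list (L * L),
           Iint (foldr (fun p acc => Imeet (Ijoin (Icompl (e p.1)) (e p.2)) acc)
                       (Itop A) ps)
           = e (foldr (fun p acc => Hmeet (Himp p.1 p.2) acc) (Htop L) ps))].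

(* rho^*(V): the variety generated by { B(L) : L in V }, presented as the
   models of all identities valid in every B(L), L in V (HSP = Mod Id). *)
Definition rho_star_eqs (E : equation HSig -> Prop) (e : equation ISig) : Prop :=
  forall (L : algebra HSig) (A : algebra ISig),
    HVariety E L -> is_BL L A -> satisfies A e.

Definition rho_star (E : equation HSig -> Prop) : algebra ISig -> Prop :=
  Mod (rho_star_eqs E).

(* Main.v *)
Require Import Defs.
From mathcomp Require Import all_boot.
From mathcomp Require Import boolp classical_sets.
From Stdlib Require List.

Set Implicit Arguments.
Unset Strict Implicit.
Unset Printing Implicit Defensive.

(** Taking open elements and forming the free Boolean extension are inverse, up
to isomorphism, between the finite members of rho^*(V) and those of V. Every
B(L) satisfies Grzegorczyk's identity, and a finite interior algebra with this
identity is generated, as a Boolean algebra, by its open elements; a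
homomorphism between the Heyting algebras of open elements then extends
uniquely to the interior algebras. Since both varieties are locally finite,
finitely presented means finite and projectivity need only be tested on finite
algebras, so corresponding algebras have equivalent quasiordered sets of
unifiers. Identities between elements of Boolean and Heyting algebras are
checked on prime filters, represented as lattice homomorphisms to bool. *)

(** * Finite types *)

(** Since [rho_star E] is given by identities, all that is known of its members is what some
    identity valid in every B(L) expresses. Three families suffice: the interior axioms,
    Grzegorczyk's identity, and the Gödel translations of the identities of [HVariety E], which
    bring the open elements back into that variety. Finiteness enters where Grzegorczyk's identity
    is turned into generation by open elements: the meet of an ultrafilter must exist inside the
    algebra. The working notion is [BL e] rather than [is_BL]: for an injection whose image
    generates A as a Boolean algebra, the formula for the interior of a conjunctive normal form
    amounts to [e] being a homomorphism into [hofi A]. Normal forms then carry the existence of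
    B(L), the extension of homomorphisms and Grzegorczyk's identity alike. Local finiteness of
    [HVariety E] is itself derived, from the fact that generators of L generate B(L). The
    correspondence of unifiers is kept as a relation, total on both sides, so that no functor has to
    be chosen. *)

Lemma is_finite_surj (T U : Type) (f : T -> U) :
  surj f -> is_finite T -> is_finite U.
Proof.
move=> sf [s sP]; exists (List.map f s) => y.
by have [x <-] := sf y; apply: List.in_map.
Qed.

Lemma is_finite_inj (T U : Type) (f : T -> U) :
  injective f -> is_finite U -> is_finite T.
Proof.
move=> fI [s sP].
suff [t tP] : exists t, forall x, List.In (f x) s -> List.In x t.
  by exists t => x; apply: tP.
elim: s {sP} => [|u s [t tP]]; first by exists [::].
have [[x fx]|nx] := pselect (exists x, f x = u).
  exists (x :: t) => y /= [uE|/tP]; last by right.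
  by left; apply: fI; rewrite fx.
exists t => y /= [uE|/tP //]; exfalso; apply: nx; by exists y.
Qed.

Lemma is_finite_sigT (T : Type) (F : T -> Type) :
  is_finite T -> (forall x, is_finite (F x)) -> is_finite {x : T & F x}.
Proof.
move=> [s sP] fF.
suff [t tP] : exists t, forall x (y : F x), List.In x s -> List.In (existT F x y) t.
  by exists t => -[x y]; apply: tP.
elim: s {sP} => [|u s [t tP]]; first by exists [::].
have [r rP] := fF u; exists (List.map (existT F u) r ++ t) => x y /= H.
apply: List.in_or_app; case: H => [uE|/(tP _ y)]; last by right.
by left; subst u; apply: List.in_map.
Qed.

Lemma is_finite_fun (n : nat) (T : Type) : is_finite T -> is_finite ('I_n -> T).
Proof.
move=> fT; elim: n => [|n IH].
  by exists [:: @noargs T] => f; left; apply: funext => -[].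
pose F (p : {x : T & 'I_n -> T}) (i : 'I_n.+1) :=
  if unlift ord0 i is Some j then projT2 p j else projT1 p.
apply: (@is_finite_surj _ _ F); last exact: is_finite_sigT.
move=> f; exists (existT _ (f ord0) (fun j => f (lift ord0 j))).
by apply: funext => i; rewrite /F; case: unliftP => [j|] ->.
Qed.

Lemma sval_inj (A : Type) (S : A -> Prop) (x y : {x : A | S x}) : sval x = sval y -> x = y.
Proof. by case: x y => [x Sx] [y Sy] /= xy; subst y; congr exist. Qed.

(** * Subalgebras, finite presentability and projectivity *)

Section Universal.
Variable sg : signature.
Implicit Types (A B C : algebra sg) (W : algebra sg -> Prop).

Lemma eval_hom A B (h : A -> B) (X : Type) (v : X -> A) (t : term sg X) :
  is_hom h -> h (eval v t) = eval (fun x => h (v x)) t.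
Proof.
move=> hh; elim: t => //= o ts IH; rewrite hh; congr (interp B o _).
by apply: funext => i; apply: IH.
Qed.

Lemma is_hom_comp A B C (f : A -> B) (g : B -> C) :
  is_hom f -> is_hom g -> is_hom (g \o f).
Proof. by move=> fh gh o a /=; rewrite fh gh. Qed.

Lemma Mod_inj (E : equation sg -> Prop) A B (f : A -> B) :
  is_hom f -> injective f -> Mod E B -> Mod E A.
Proof.
move=> fh fI mB e /mB eB v; apply: fI; rewrite !eval_hom //; exact: eB.
Qed.

Definition closed_under A (S : A -> Prop) : Prop :=
  forall o (args : 'I_(arity o) -> A),
    (forall i, S (args i)) -> S (interp A o args).

Definition subalg A (S : A -> Prop) (cS : closed_under S) : algebra sg :=
  @Algebra sg {x : A | S x} (fun o args =>
    exist S (interp A o (fun i => sval (args i))) (cS o _ (fun i => svalP (args i)))).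

Lemma sval_hom A (S : A -> Prop) (cS : closed_under S) :
  is_hom (fun x : subalg cS => sval x : A).
Proof. by []. Qed.

Arguments sval_hom [A S] cS.

Lemma Mod_subalg E A (S : A -> Prop) (cS : closed_under S) :
  Mod E A -> Mod E (subalg cS).
Proof. by apply: (Mod_inj (sval_hom cS)) => x y; apply: sval_inj. Qed.

Arguments Mod_subalg [E A S] cS _.

Lemma span_closed A (X : Type) (a : X -> A) :
  closed_under (fun x => exists t, eval a t = x).
Proof.
move=> o args /choice [ts tsP]; exists (App o ts) => /=.
by congr (interp A o _); apply: funext.
Qed.

Arguments span_closed [A X] a.

Definition span A (X : Type) (a : X -> A) : algebra sg := subalg (span_closed a).

Definition span_gen A (X : Type) (a : X -> A) (x : X) : span a :=
  exist _ (a x) (ex_intro _ (Var x) erefl).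

Lemma span_generated A (X : Type) (a : X -> A) : generated_by (@span_gen A X a).
Proof.
by move=> [y [t ty]]; exists t; apply: sval_inj; rewrite (eval_hom _ _ (sval_hom _)).
Qed.

Lemma generated_self A : generated_by (fun x : A => x).
Proof. by move=> x; exists (Var x). Qed.

(** The presentation is the operation table: every element is a generator, every value of an
    operation a relation. It is finite because the signature and the arities are. *)
Lemma finite_fin_presented W A :
  is_finite (op_sym sg) -> W A -> is_finite A -> fin_presented W A.
Proof.
move=> fo WA fA; split=> //.
have [s sP] : is_finite {o : op_sym sg & 'I_(arity o) -> A}.
  by apply: is_finite_sigT => // o; apply: is_finite_fun.
pose rl (p : {o : op_sym sg & 'I_(arity o) -> A}) :=
  (App (projT1 p) (fun i => Var (projT2 p i)), @Var sg _ (interp A (projT1 p) (projT2 p))).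
exists A, id, (List.map rl s); split=> //.
- exact: generated_self.
- by move=> p /List.in_map_iff [[o args] [<- _]].
- move=> B WB b bR; exists b; split=> // o args.
  by symmetry; exact: (bR _ (List.in_map rl _ _ (sP (existT _ o args)))).
Qed.

Lemma fin_presented_finite W A :
  locally_finite W -> fin_presented W A -> is_finite A.
Proof. by move=> lf [WA [X [a [R [fX gA _ _]]]]]; apply: lf => //; exists X, a. Qed.

Definition fin_projective W B : Prop :=
  forall A C, W A -> W C -> is_finite A -> is_finite C ->
  forall f : A -> C, is_hom f -> surj f ->
  forall g : B -> C, is_hom g ->
  exists h : B -> A, is_hom h /\ forall x, f (h x) = g x.

(* Lift the images of the elements of B arbitrarily, and restrict f to the
   subalgebras generated by these lifts and by the image of B. *)
Lemma fin_projectiveP E B :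
  locally_finite (Mod E) -> Mod E B -> is_finite B ->
  projective (Mod E) B <-> fin_projective (Mod E) B.
Proof.
move=> lf WB fB; split=> [[_ pB] A C WA WC _ _ f fh fs g gh|fp]; first exact: pB.
split=> // A C WA WC f fh fs g gh.
have [a aP] := choice (fun x : B => fs (g x)).
have fE t : f (eval a t) = eval g t.
  by rewrite eval_hom //; congr (eval _ t); apply: funext.
have fin (D : algebra sg) (d : B -> D) : Mod E D -> is_finite (span d).
  move=> WD; apply: lf; first exact: (Mod_subalg (span_closed d)).
  by exists B, (@span_gen D B d); split=> //; apply: span_generated.
have fS (x : span a) : exists t, eval g t = f (sval x).
  by case: x => x [t tx]; exists t; rewrite -fE tx.
pose f' (x : span a) : span g := exist _ (f (sval x)) (fS x).
pose g' (x : B) : span g := span_gen g x.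
have [] := fp _ _ (Mod_subalg (span_closed a) WA) (Mod_subalg (span_closed g) WC)
  (fin _ _ WA) (fin _ _ WC) f' _ _ g'.
- by move=> o args; apply: sval_inj; rewrite /= fh.
- move=> [y [t ty]]; exists (exist _ (eval a t) (ex_intro _ t erefl)).
  by apply: sval_inj; rewrite /= fE.
- by move=> o args; apply: sval_inj; rewrite /= gh.
- move=> h [hh hP]; exists (fun x => sval (h x)); split=> [o args|x]; first by rewrite hh.
  by have := congr1 sval (hP x).
Qed.

End Universal.

Arguments sval_hom [sg A S] cS.
Arguments Mod_subalg [sg E A S] cS _.

(** * Transfer of unification types *)

Section Transfer.
Variables (sg1 sg2 : signature) (W1 : algebra sg1 -> Prop) (W2 : algebra sg2 -> Prop).

(** Each of the four types depends only on which index types carry a mu-set, so this is all that a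
    correspondence of algebras has to preserve. *)
Definition same_types (A : algebra sg1) (B : algebra sg2) : Prop :=
  (unifiable W1 A <-> unifiable W2 B) /\
  forall I : Type, (exists M : I -> unifier W1 A, mu_set M) <->
                   (exists M : I -> unifier W2 B, mu_set M).

(** [R] need not be a function: its preserving and reflecting the quasiorder makes any two partners
    of one unifier equivalent, so arbitrary partners of the members of [M] form a mu-set over the
    same index type. *)
Lemma mu_set_transfer (A : algebra sg1) (B : algebra sg2)
  (R : unifier W1 A -> unifier W2 B -> Prop) (I : Type) (M : I -> unifier W1 A) :
  (forall U, exists U', R U U') -> (forall U', exists U, R U U') ->
  (forall U V U' V', R U U' -> R V V' -> more_general U V <-> more_general U' V') ->
  mu_set M -> exists M' : I -> unifier W2 B, mu_set M'.
Proof.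
move=> R1 R2 RP [dM aM].
have [M' M'P] := choice (fun i => R1 (M i)).
exists M'; split=> [V|i j ij /(RP _ _ _ _ (M'P i) (M'P j))]; last exact: aM.
have [U UV] := R2 V; have [i iU] := dM U; exists i; exact/(RP _ _ _ _ (M'P i) UV).
Qed.

Lemma variety_type_imp (k : unif_type) :
  (forall A, fin_presented W1 A -> exists B, fin_presented W2 B /\ same_types A B) ->
  (forall B, fin_presented W2 B -> exists A, fin_presented W1 A /\ same_types A B) ->
  variety_type W1 k -> variety_type W2 k.
Proof.
move=> H12 H21.
have t1 A B : same_types A B -> has_type_1 W1 A -> has_type_1 W2 B.
  by move=> [_ AB] [I [M [mM i0]]]; have /AB[M' mM'] := ex_intro _ M mM; exists I, M'.
have tw A B : same_types A B -> has_type_omega W1 A -> has_type_omega W2 B.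
  by move=> [_ AB] [I [M [mM i0 i1]]]; have /AB[M' mM'] := ex_intro _ M mM; exists I, M'.
have ti A B : same_types A B -> has_type_infty W1 A -> has_type_infty W2 B.
  by move=> [_ AB] [I [M [mM i0]]]; have /AB[M' mM'] := ex_intro _ M mM; exists I, M'.
have t0 A B : same_types A B -> has_type_0 W1 A -> has_type_0 W2 B.
  by move=> [_ AB] nA [I /AB[M mM]]; apply: nA; exists I, M.
have allP (P1 : algebra sg1 -> Prop) (P2 : algebra sg2 -> Prop) :
    (forall A B, same_types A B -> P1 A -> P2 B) ->
    (forall A, fin_presented W1 A -> unifiable W1 A -> P1 A) ->
    (forall B, fin_presented W2 B -> unifiable W2 B -> P2 B).
  move=> P12 P B /H21 [A [fA AB]] uB; apply: (P12 _ _ AB) (P _ fA _); exact/AB.1.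
have exP (P1 : algebra sg1 -> Prop) (P2 : algebra sg2 -> Prop) :
    (forall A B, same_types A B -> P1 A -> P2 B) ->
    (exists A, [/\ fin_presented W1 A, unifiable W1 A & P1 A]) ->
    (exists B, [/\ fin_presented W2 B, unifiable W2 B & P2 B]).
  move=> P12 [A [/H12 [B [fB AB]] uA PA]]; exists B; split=> //; first exact/AB.1.
  exact: P12 AB PA.
case: k => /=.
- exact: (allP (has_type_1 W1)).
- move=> [Ha He]; split; last exact: (exP _ _ tw He).
  apply: (allP (fun A => has_type_1 W1 A \/ has_type_omega W1 A)) Ha => A B AB.
  by move=> [/(t1 _ _ AB)|/(tw _ _ AB)]; [left|right].
- move=> [Ha He]; split; last exact: (exP _ _ ti He).
  apply: (allP (fun A =>
    [\/ has_type_1 W1 A, has_type_omega W1 A | has_type_infty W1 A])) Ha => A B AB.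
  move=> [/(t1 _ _ AB)|/(tw _ _ AB)|/(ti _ _ AB)];
    [exact: Or31|exact: Or32|exact: Or33].
- exact: exP.
Qed.

End Transfer.

Lemma same_types_sym (sg1 sg2 : signature) (W1 : algebra sg1 -> Prop)
    (W2 : algebra sg2 -> Prop) A B :
  same_types W1 W2 A B -> same_types W2 W1 B A.
Proof. by move=> [u m]; split=> [|I]; [split=> /u|split=> /m]. Qed.

(** * Points of distributive lattices *)

(** Stated for bare operations so that one prime filter theorem serves both signatures. *)
Record lattice_axioms (T : Type) (m j : T -> T -> T) (b t : T) : Prop := LatticeAxioms {
  lat_mC : forall x y, m x y = m y x;
  lat_jC : forall x y, j x y = j y x;
  lat_mA : forall x y z, m x (m y z) = m (m x y) z;
  lat_jA : forall x y z, j x (j y z) = j (j x y) z;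
  lat_mK : forall x y, m x (j x y) = x;
  lat_jK : forall x y, j x (m x y) = x;
  lat_j0 : forall x, j x b = x;
  lat_m1 : forall x, m x t = x }.

Record is_point (T : Type) (m j : T -> T -> T) (b t : T) (F : T -> bool) : Prop := IsPoint {
  ptM : forall x y, F (m x y) = F x && F y;
  ptJ : forall x y, F (j x y) = F x || F y;
  pt0 : F b = false;
  pt1 : F t = true }.

Section Lattice.
Variables (T : Type) (m j : T -> T -> T) (b t : T).
Hypothesis lat : lattice_axioms m j b t.

Definition lle (x y : T) : Prop := m x y = x.

Lemma lat_mxx x : m x x = x.
Proof. by rewrite -{2}(lat_jK lat x x) (lat_mK lat). Qed.

Lemma lle_refl x : lle x x. Proof. exact: lat_mxx. Qed.

Lemma lle_anti x y : lle x y -> lle y x -> x = y.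
Proof. by rewrite /lle => xy <-; rewrite (lat_mC lat). Qed.

Lemma lle_trans y x z : lle x y -> lle y z -> lle x z.
Proof. by rewrite /lle => xy yz; rewrite -xy -(lat_mA lat) yz. Qed.

Lemma lle_ml x y : lle (m x y) x.
Proof. by rewrite /lle (lat_mC lat) (lat_mA lat) lat_mxx. Qed.

Lemma lle_mr x y : lle (m x y) y.
Proof. by rewrite (lat_mC lat); apply: lle_ml. Qed.

Lemma lle_m z x y : lle z x -> lle z y -> lle z (m x y).
Proof. by rewrite /lle => zx zy; rewrite (lat_mA lat) zx. Qed.

Lemma lle_jl x y : lle x (j x y). Proof. exact: (lat_mK lat). Qed.

Lemma lle_jr x y : lle y (j x y).
Proof. by rewrite (lat_jC lat); apply: lle_jl. Qed.

Lemma lle_joinE x y : lle x y -> j x y = y.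
Proof. by rewrite /lle => <-; rewrite (lat_jC lat) (lat_mC lat) (lat_jK lat). Qed.

Lemma lle_j x y z : lle x z -> lle y z -> lle (j x y) z.
Proof.
move=> xz yz; suff <- : j (j x y) z = z by apply: lle_jl.
by rewrite -(lat_jA lat) (lle_joinE yz) (lle_joinE xz).
Qed.

Lemma lle_m2 x y x' y' : lle x x' -> lle y y' -> lle (m x y) (m x' y').
Proof.
by move=> xx yy; apply: lle_m; [apply: lle_trans xx; apply: lle_ml
                               |apply: lle_trans yy; apply: lle_mr].
Qed.

Definition lat_filter (F : T -> Prop) : Prop :=
  F t /\ forall x y, F (m x y) <-> F x /\ F y.

Lemma filter_up F x y : lat_filter F -> lle x y -> F x -> F y.
Proof. by move=> [_ Fm] xy Fx; apply: (proj2 (proj1 (Fm x y) _)); rewrite xy. Qed.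

Hypothesis distr : forall x y z, m x (j y z) = j (m x y) (m x z).

(** By Zorn's lemma there is a maximal filter among those that extend [F] and omit [v];
    distributivity makes it prime. *)
Lemma prime_filter (F : T -> Prop) (v : T) :
  lat_filter F -> ~ F v ->
  exists G : T -> bool, [/\ is_point m j b t G, forall x, F x -> G x & G v = false].
Proof.
move=> fF Fv.
pose good G := [/\ lat_filter G, forall x, F x -> G x & ~ G v].
pose R (G H : {G : T -> Prop | good G}) := `[< forall x, sval G x -> sval H x >].
have [] := @Zorn _ R.
- by move=> G; apply/asboolP.
- by move=> G H K /asboolP GH /asboolP HK; apply/asboolP => x /GH /HK.
- move=> G H /asboolP GH /asboolP HG; apply: sval_inj; apply: funext => x; apply: propext.
  by split=> [/GH|/HG].
(* The empty chain is bounded by [F] itself, since its union would not contain the top element; any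
   other chain is bounded by its union. *)
- move=> A tA; have [[G0 AG0]|nA] := pselect (exists G, A G); last first.
    have gF : good F by split.
    by exists (exist _ F gF) => G AG; exfalso; apply: nA; exists G.
  pose U x := exists2 G, A G & sval G x.
  have gU : good U.
    split.
    + split; first by exists G0 => //; case: (svalP G0) => -[].
      move=> x y; split=> [[G AG]|[[G AG Gx] [H AH Hy]]].
        by case: (svalP G) => -[_ Gm] _ _ /Gm [Gx Gy]; split; exists G.
      case: (tA _ _ AG AH) => [/asboolP GH|/asboolP HG].
        exists H => //; case: (svalP H) => -[_ Hm] _ _; apply/Hm; split=> //; exact: GH.
      exists G => //; case: (svalP G) => -[_ Gm] _ _; apply/Gm; split=> //; exact: HG.
    + by move=> x Fx; exists G0 => //; case: (svalP G0) => _ + _; apply.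
    + by move=> [G AG Gv]; case: (svalP G).
  by exists (exist _ U gU) => G AG; apply/asboolP => x Gx; exists G.
move=> [G [fG FG Gv]] Gmax.
(* Otherwise the filter [H] generated by [G] and [x] would still omit [v], and maximality would put
   [x] into [G]. *)
have ext x : ~ G x -> exists2 a, G a & lle (m a x) v.
  move=> nGx; apply: contrapT => nv; apply: nGx.
  pose H z := exists2 a, G a & lle (m a x) z.
  have GH z : G z -> H z by move=> Gz; exists z => //; apply: lle_ml.
  have gH : good H.
    split=> //; last by move=> z /FG /GH.
    split; first by apply: GH; exact: fG.1.
    move=> y z; split=> [[a Ga ayz]|[[a Ga ay] [c Gc cz]]].
      by split; exists a => //; apply: lle_trans ayz _; [apply: lle_ml|apply: lle_mr].
    exists (m a c); first by apply/fG.2.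
    by apply: lle_m; [apply: lle_trans ay|apply: lle_trans cz]; apply: lle_m2;
      rewrite ?lat_mxx; try exact: lle_refl; [apply: lle_ml|apply: lle_mr].
  have /(congr1 sval) /= <- := Gmax (exist _ H gH) (asboolT GH).
  by exists t; [exact: fG.1|apply: lle_mr].
move: Gmax => _; exists (fun x => `[< G x >]); split; last by apply/asboolP.
- split.
  + move=> x y; apply/asboolP/andP => [/fG.2 [? ?]|[/asboolP ? /asboolP ?]].
      by split; apply/asboolP.
    exact/fG.2.
  + move=> x y; apply/asboolP/orP => [Gxy|[/asboolP|/asboolP]]; last 2 first.
    * by apply: filter_up => //; apply: lle_jl.
    * by apply: filter_up => //; apply: lle_jr.
    have [Gx|/ext [a Ga ax]] := pselect (G x); first by left; apply/asboolP.
    have [Gy|/ext [c Gc cy]] := pselect (G y); first by right; apply/asboolP.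
    (* If both joinands are outside [G], the witnesses [a] and [c] combine: distributivity puts the
       meet of [a], [c] and the join of [x] and [y] below [v]. *)
    exfalso; apply: Gv; apply: (@filter_up G (m (m a c) (j x y))) => //; last first.
      by apply/fG.2; split=> //; apply/fG.2.
    rewrite distr; apply: lle_j.
      by apply: lle_trans ax; apply: lle_m2; [apply: lle_ml|apply: lle_refl].
    by apply: lle_trans cy; apply: lle_m2; [apply: lle_mr|apply: lle_refl].
  + apply/asboolP => Gb; apply: Gv; apply: filter_up Gb => //.
    by rewrite /lle -{1}(lat_j0 lat v) (lat_jC lat) (lat_mK lat).
  + by apply/asboolP; exact: fG.1.
- by move=> x Fx; apply/asboolP; exact: FG.
Qed.

Lemma lleP x y :
  lle x y <-> forall G, is_point m j b t G -> G x -> G y.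
Proof.
split=> [xy G pG Gx|H]; first by move: Gx; rewrite -xy (ptM pG) => /andP[].
apply: contrapT => nxy.
have [|G [pG FG]] := @prime_filter (lle x) y _ nxy; last by rewrite H // FG //; apply: lle_refl.
split; first exact: (lat_m1 lat).
move=> y' z; split=> [xyz|[xy' xz]]; last exact: lle_m.
by split; apply: lle_trans xyz _; [apply: lle_ml|apply: lle_mr].
Qed.

Lemma point_ext x y :
  (forall G, is_point m j b t G -> G x = G y) -> x = y.
Proof. by move=> H; apply: lle_anti; apply/lleP => G /H ->. Qed.

End Lattice.

(** * Heyting algebras and interior algebras *)

Lemma args2E (T : Type) (a : 'I_2 -> T) : a = args2 (a ord0) (a ord_max).
Proof.
by apply: funext => -[[|[|//]] i2]; rewrite /args2 /=; congr a; apply: val_inj.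
Qed.

Lemma args1E (T : Type) (a : 'I_1 -> T) : a = args1 (a ord0).
Proof. by apply: funext => i; rewrite /args1 (ord1 i). Qed.

Lemma args0E (T : Type) (a : 'I_0 -> T) : a = @noargs T.
Proof. by apply: funext => -[]. Qed.

Lemma args2_comp (T U : Type) (f : T -> U) (x y : T) :
  (fun i => f (args2 x y i)) = args2 (f x) (f y).
Proof. by rewrite [LHS]args2E. Qed.

Definition val3 (T : Type) (x y z : T) (n : nat) : T :=
  match n with 0 => x | 1 => y | _ => z end.

Lemma eval_hmeet (L : algebra HSig) X (v : X -> L) s t :
  eval v (hmeet s t) = Hmeet (eval v s) (eval v t).
Proof. by rewrite /= args2_comp. Qed.

Lemma eval_hjoin (L : algebra HSig) X (v : X -> L) s t :
  eval v (hjoin s t) = Hjoin (eval v s) (eval v t).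
Proof. by rewrite /= args2_comp. Qed.

Lemma eval_himp (L : algebra HSig) X (v : X -> L) s t :
  eval v (himp s t) = Himp (eval v s) (eval v t).
Proof. by rewrite /= args2_comp. Qed.

Lemma eval_hbot (L : algebra HSig) X (v : X -> L) : eval v hbot = Hbot L.
Proof. by rewrite /= [X in interp _ _ X]args0E. Qed.

Lemma eval_htop (L : algebra HSig) X (v : X -> L) : eval v htop = Htop L.
Proof. by rewrite /= [X in interp _ _ X]args0E. Qed.

Lemma eval_imeet (A : algebra ISig) X (v : X -> A) s t :
  eval v (imeet s t) = Imeet (eval v s) (eval v t).
Proof. by rewrite /= args2_comp. Qed.

Lemma eval_ijoin (A : algebra ISig) X (v : X -> A) s t :
  eval v (ijoin s t) = Ijoin (eval v s) (eval v t).
Proof. by rewrite /= args2_comp. Qed.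

Lemma eval_icompl (A : algebra ISig) X (v : X -> A) s :
  eval v (icompl s) = Icompl (eval v s).
Proof. by []. Qed.

Lemma eval_iint (A : algebra ISig) X (v : X -> A) s :
  eval v (iint s) = Iint (eval v s).
Proof. by []. Qed.

Lemma eval_ibot (A : algebra ISig) X (v : X -> A) : eval v ibot = Ibot A.
Proof. by rewrite /= [X in interp _ _ X]args0E. Qed.

Lemma eval_itop (A : algebra ISig) X (v : X -> A) : eval v itop = Itop A.
Proof. by rewrite /= [X in interp _ _ X]args0E. Qed.

Definition eval_hE := (eval_hmeet, eval_hjoin, eval_himp, eval_hbot, eval_htop).
Definition eval_iE :=
  (eval_imeet, eval_ijoin, eval_icompl, eval_iint, eval_ibot, eval_itop).

Ltac in_list :=
  rewrite /HA_axioms /IA_axioms /=; repeat first [left; reflexivity | right].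

Section Heyting.
Variable L : algebra HSig.
Hypothesis HL : Mod HA_axioms L.
Implicit Types x y z : L.

Lemma heyting_lattice : lattice_axioms (@Hmeet L) (@Hjoin L) (Hbot L) (Htop L).
Proof.
have H e : HA_axioms e -> forall x y z, eval (val3 x y z) e.1 = eval (val3 x y z) e.2.
  by move=> /HL eL x y z; apply: eL.
split=> [x y|x y|x y z|x y z|x y|x y|x|x].
- by have := H (hmeet hx hy, hmeet hy hx) ltac:(in_list) x y y; rewrite /fst /snd !eval_hE.
- by have := H (hjoin hx hy, hjoin hy hx) ltac:(in_list) x y y; rewrite /fst /snd !eval_hE.
- by have := H (hmeet hx (hmeet hy hz), hmeet (hmeet hx hy) hz) ltac:(in_list) x y z;
    rewrite /fst /snd !eval_hE.
- by have := H (hjoin hx (hjoin hy hz), hjoin (hjoin hx hy) hz) ltac:(in_list) x y z;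
    rewrite /fst /snd !eval_hE.
- by have := H (hmeet hx (hjoin hx hy), hx) ltac:(in_list) x y y; rewrite /fst /snd !eval_hE.
- by have := H (hjoin hx (hmeet hx hy), hx) ltac:(in_list) x y y; rewrite /fst /snd !eval_hE.
- by have := H (hjoin hx hbot, hx) ltac:(in_list) x x x; rewrite /fst /snd !eval_hE.
- by have := H (hmeet hx htop, hx) ltac:(in_list) x x x; rewrite /fst /snd !eval_hE.
Qed.

Lemma Himpxx x : Himp x x = Htop L.
Proof.
have := HL (e := (himp hx hx, htop)) ltac:(in_list) (val3 x x x).
by rewrite /fst /snd !eval_hE.
Qed.

Lemma Hmeet_imp x y : Hmeet x (Himp x y) = Hmeet x y.
Proof.
have := HL (e := (hmeet hx (himp hx hy), hmeet hx hy)) ltac:(in_list) (val3 x y y).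
by rewrite /fst /snd !eval_hE.
Qed.

Lemma Hmeet_impr x y : Hmeet y (Himp x y) = y.
Proof.
have := HL (e := (hmeet hy (himp hx hy), hy)) ltac:(in_list) (val3 x y y).
by rewrite /fst /snd !eval_hE.
Qed.

Lemma Himp_meet x y z : Himp x (Hmeet y z) = Hmeet (Himp x y) (Himp x z).
Proof.
have := HL (e := (himp hx (hmeet hy hz), hmeet (himp hx hy) (himp hx hz)))
  ltac:(in_list) (val3 x y z).
by rewrite /fst /snd !eval_hE.
Qed.

Let lat := heyting_lattice.
Local Notation "x <=< y" := (lle (@Hmeet L) x y) (at level 70).

Lemma heyting_residuation x y z : Hmeet z x <=< y <-> z <=< Himp x y.
Proof.
split=> H.
  have zi : z <=< Himp x (Hmeet z x).
    by rewrite Himp_meet Himpxx (lat_m1 lat); apply: Hmeet_impr.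
  by apply: (lle_trans lat) zi _; rewrite -H Himp_meet; apply: (lle_mr lat).
apply: (lle_trans lat (y := Hmeet x y)); last exact: (lle_mr lat).
by rewrite -(Hmeet_imp x y) (lat_mC lat z); apply: (lle_m2 lat) => //; apply: (lle_refl lat).
Qed.

Lemma heyting_distr x y z : Hmeet x (Hjoin y z) = Hjoin (Hmeet x y) (Hmeet x z).
Proof.
apply: (lle_anti lat).
  rewrite (lat_mC lat); apply/heyting_residuation; apply: (lle_j lat);
    apply/heyting_residuation; rewrite (lat_mC lat).
    exact: (lle_jl lat).
  exact: (lle_jr lat).
by apply: (lle_j lat); apply: (lle_m2 lat); try exact: (lle_refl lat);
  [apply: (lle_jl lat)|apply: (lle_jr lat)].
Qed.

Lemma Himp1x x : Himp (Htop L) x = x.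
Proof.
have m1x y : Hmeet (Htop L) y = y by rewrite (lat_mC lat) (lat_m1 lat).
by rewrite -[LHS]m1x Hmeet_imp m1x.
Qed.

Definition hpoint := is_point (@Hmeet L) (@Hjoin L) (Hbot L) (Htop L).

(** Kripke semantics of implication on the prime filters. For the converse, if [F] omits x => y,
    then the z with x => z in [F] form a filter that extends [F], contains x and omits y; a prime
    extension of it is the counterexample. *)
Lemma hpoint_imp F x y : hpoint F ->
  F (Himp x y) <-> forall G, hpoint G -> (forall z, F z -> G z) -> G x -> G y.
Proof.
move=> pF; split=> [Fxy G pG FG Gx|H].
  have : G (Hmeet x (Himp x y)) by rewrite (ptM pG) Gx FG.
  by rewrite Hmeet_imp (ptM pG) => /andP[].
apply: contrapT => nF.
have [] := @prime_filter _ _ _ _ _ lat heyting_distr (fun z => F (Himp x z)) y _ nF.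
  split; first by rewrite -[Himp _ _](lat_m1 lat) (lat_mC lat) Hmeet_impr (pt1 pF).
  by move=> z w; rewrite Himp_meet (ptM pF); split=> /andP.
move=> G [pG FG]; rewrite H //; last by apply: FG; rewrite Himpxx (pt1 pF).
by move=> z Fz; apply: FG; move: Fz; rewrite -{1}(Hmeet_impr x z) (ptM pF) => /andP[].
Qed.

End Heyting.

Section Interior.
Variable A : algebra ISig.
Hypothesis IA : Mod IA_axioms A.
Implicit Types a b c : A.

Let ax e (H : IA_axioms e) a b c : eval (val3 a b c) e.1 = eval (val3 a b c) e.2 := IA H _.

Lemma interior_lattice : lattice_axioms (@Imeet A) (@Ijoin A) (Ibot A) (Itop A).
Proof.
split=> [x y|x y|x y z|x y z|x y|x y|x|x].
- by have := ax (e := (imeet ix iy, imeet iy ix)) ltac:(in_list) x y y; rewrite /fst /snd !eval_iE.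
- by have := ax (e := (ijoin ix iy, ijoin iy ix)) ltac:(in_list) x y y; rewrite /fst /snd !eval_iE.
- by have := ax (e := (imeet ix (imeet iy iz), imeet (imeet ix iy) iz))
    ltac:(in_list) x y z; rewrite /fst /snd !eval_iE.
- by have := ax (e := (ijoin ix (ijoin iy iz), ijoin (ijoin ix iy) iz))
    ltac:(in_list) x y z; rewrite /fst /snd !eval_iE.
- by have := ax (e := (imeet ix (ijoin ix iy), ix)) ltac:(in_list) x y y; rewrite /fst /snd !eval_iE.
- by have := ax (e := (ijoin ix (imeet ix iy), ix)) ltac:(in_list) x y y; rewrite /fst /snd !eval_iE.
- by have := ax (e := (ijoin ix ibot, ix)) ltac:(in_list) x x x; rewrite /fst /snd !eval_iE.
- by have := ax (e := (imeet ix itop, ix)) ltac:(in_list) x x x; rewrite /fst /snd !eval_iE.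
Qed.

Lemma interior_distr a b c : Imeet a (Ijoin b c) = Ijoin (Imeet a b) (Imeet a c).
Proof.
have := ax (e := (imeet ix (ijoin iy iz), ijoin (imeet ix iy) (imeet ix iz)))
  ltac:(in_list) a b c.
by rewrite /fst /snd !eval_iE.
Qed.

Lemma Iint_top : Iint (Itop A) = Itop A.
Proof.
have := ax (e := (iint itop, itop)) ltac:(in_list) (Itop A) (Itop A) (Itop A).
by rewrite /fst /snd !eval_iE.
Qed.

Lemma Iint_meet a b : Iint (Imeet a b) = Imeet (Iint a) (Iint b).
Proof.
have := ax (e := (iint (imeet ix iy), imeet (iint ix) (iint iy))) ltac:(in_list) a b b.
by rewrite /fst /snd !eval_iE.
Qed.

Lemma Iint_idem a : Iint (Iint a) = Iint a.
Proof.
have := ax (e := (iint (iint ix), iint ix)) ltac:(in_list) a a a.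
by rewrite /fst /snd !eval_iE.
Qed.

Definition ipoint := is_point (@Imeet A) (@Ijoin A) (Ibot A) (Itop A).

Lemma ptC F a : ipoint F -> F (Icompl a) = ~~ F a.
Proof.
move=> pF.
have := ax (e := (imeet ix (icompl ix), ibot)) ltac:(in_list) a a a.
have := ax (e := (ijoin ix (icompl ix), itop)) ltac:(in_list) a a a.
rewrite /fst /snd !eval_iE => /(congr1 F) + /(congr1 F).
by rewrite (ptM pF) (ptJ pF) (pt0 pF) (pt1 pF) /=; case: (F a); case: (F _).
Qed.

Definition ipE F (pF : ipoint F) := (ptM pF, ptJ pF, pt0 pF, pt1 pF, fun a => ptC a pF).

Lemma bool_ext a b : (forall F, ipoint F -> F a = F b) -> a = b.
Proof. exact: (point_ext interior_lattice interior_distr). Qed.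

(** The order is read off the ultrafilters, so that Boolean inequalities become case analyses on
    truth values. *)
Definition ble a b : Prop := forall F, ipoint F -> F a -> F b.

Lemma bleE a b : ble a b <-> Imeet a b = a.
Proof. by split=> /(lleP interior_lattice interior_distr). Qed.

Lemma ble_anti a b : ble a b -> ble b a -> a = b.
Proof. by move=> ab ba; apply: bool_ext => F pF; apply/idP/idP; [apply: ab|apply: ba]. Qed.

Lemma ble_trans b a c : ble a b -> ble b c -> ble a c.
Proof. by move=> ab bc F pF /(ab F pF) /(bc F pF). Qed.

Lemma Iint_le a : ble (Iint a) a.
Proof.
apply/bleE; have := ax (e := (imeet (iint ix) ix, iint ix)) ltac:(in_list) a a a.
by rewrite /fst /snd !eval_iE.
Qed.

Lemma Iint_mono a b : ble a b -> ble (Iint a) (Iint b).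
Proof. by move=> /bleE ab; apply/bleE; rewrite -Iint_meet ab. Qed.

Lemma Iint_joinI a b : Iint (Ijoin (Iint a) (Iint b)) = Ijoin (Iint a) (Iint b).
Proof.
apply: ble_anti; first exact: Iint_le.
have iu c d : ble (Iint c) d -> ble (Iint c) (Iint d).
  by move=> cd; rewrite -(Iint_idem c); apply: Iint_mono.
move=> F pF; rewrite (ptJ pF) => /orP[]; apply: iu => // G pG; rewrite (ptJ pG) => -> //.
by rewrite orbT.
Qed.

Lemma Iint_bot : Iint (Ibot A) = Ibot A.
Proof. by apply: ble_anti; [apply: Iint_le|move=> F pF; rewrite (pt0 pF)]. Qed.

Definition Icl a : A := Icompl (Iint (Icompl a)).

Lemma Icl_mono a b : ble a b -> ble (Icl a) (Icl b).
Proof.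
move=> ab F pF; rewrite !(ptC _ pF); apply: contra; apply: Iint_mono pF.
by move=> G pG; rewrite !(ptC _ pG); apply: contra; apply: ab.
Qed.

Lemma Icl_bot : Icl (Ibot A) = Ibot A.
Proof.
have -> : Icl (Ibot A) = Icompl (Iint (Itop A)).
  by congr (Icompl (Iint _)); apply: bool_ext => F pF; rewrite !(ipE pF).
by rewrite Iint_top; apply: bool_ext => F pF; rewrite !(ipE pF).
Qed.

(** Topologically: a neighbourhood inside [u] of a point in the closure of [a] already meets [a]
    within [u]. This lets arguments about closures be restricted to an open element. *)
Lemma open_meet_Icl u a : Iint u = u -> ble (Imeet u (Icl a)) (Icl (Imeet u a)).
Proof.
move=> uo F pF; rewrite (ptM pF) !(ptC _ pF) => /andP[Fu]; apply: contra => Fg.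
have : F (Iint (Imeet u (Icompl (Imeet u a)))) by rewrite Iint_meet uo (ptM pF) Fu.
apply: Iint_mono pF => G pG; rewrite !(ipE pG); by case: (G u); case: (G a).
Qed.

End Interior.

(** * The Gödel translation *)

Definition opI (A : algebra ISig) (o : op_sym HSig) : ('I_(arity o) -> A) -> A :=
  match o return ('I_(@arity HSig o) -> A) -> A with
  | HMeet => fun a => Imeet (a ord0) (a ord_max)
  | HJoin => fun a => Ijoin (a ord0) (a ord_max)
  | HImp => fun a => Ijoin (Icompl (a ord0)) (a ord_max)
  | HBot => fun _ => Ibot A
  | HTop => fun _ => Itop A
  end.

(* The Heyting algebra of open elements, extended to all of A by applying the
   interior operator after each operation. *)
Definition hofi (A : algebra ISig) : algebra HSig :=
  @Algebra HSig A (fun o a => Iint (opI a)).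

Lemma hom_Imeet (A B : algebra ISig) (h : A -> B) a b :
  is_hom h -> h (Imeet a b) = Imeet (h a) (h b).
Proof. by move=> hh; rewrite /Imeet hh args2_comp. Qed.

Lemma hom_Ijoin (A B : algebra ISig) (h : A -> B) a b :
  is_hom h -> h (Ijoin a b) = Ijoin (h a) (h b).
Proof. by move=> hh; rewrite /Ijoin hh args2_comp. Qed.

Lemma hom_Icompl (A B : algebra ISig) (h : A -> B) a :
  is_hom h -> h (Icompl a) = Icompl (h a).
Proof. by move=> hh; rewrite /Icompl hh. Qed.

Lemma hom_Iint (A B : algebra ISig) (h : A -> B) a :
  is_hom h -> h (Iint a) = Iint (h a).
Proof. by move=> hh; rewrite /Iint hh. Qed.

Lemma hom_Ibot (A B : algebra ISig) (h : A -> B) : is_hom h -> h (Ibot A) = Ibot B.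
Proof. by move=> hh; rewrite /Ibot hh; congr (interp B _ _); apply: args0E. Qed.

Lemma hom_Itop (A B : algebra ISig) (h : A -> B) : is_hom h -> h (Itop A) = Itop B.
Proof. by move=> hh; rewrite /Itop hh; congr (interp B _ _); apply: args0E. Qed.

Lemma hofi_hom (A B : algebra ISig) (h : A -> B) :
  is_hom h -> is_hom (h : hofi A -> hofi B).
Proof.
move=> hh o a; rewrite /= hom_Iint //; congr Iint.
by case: o a => a /=; rewrite ?(hom_Imeet, hom_Ijoin, hom_Icompl, hom_Ibot, hom_Itop).
Qed.

Definition term_alg (X : Type) : algebra ISig := @Algebra ISig (term ISig X) (@App ISig X).

Lemma eval_is_hom (A : algebra ISig) (X : Type) (v : X -> A) :
  is_hom (eval v : term_alg X -> A).
Proof. by []. Qed.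

(** The variant of the translation that puts an interior in front of every subterm, variables
    included. *)
Fixpoint godel (X : Type) (t : term HSig X) : term ISig X :=
  match t with
  | Var x => iint (Var x)
  | App o ts => iint (@opI (term_alg X) o (fun i => godel (ts i)))
  end.

Lemma eval_godel (A : algebra ISig) (X : Type) (v : X -> A) (t : term HSig X) :
  eval v (godel t) = eval (A := hofi A) (fun x => Iint (v x)) t.
Proof.
elim: t => //= o ts IH.
(* The translation of an application is an operation of [hofi] of the term algebra, and evaluation
   is a homomorphism from that algebra. *)
rewrite -[LHS]/(eval v (@interp _ (hofi (term_alg X)) o (fun i => godel (ts i)))).
rewrite (hofi_hom (@eval_is_hom A X v)) /=; congr (Iint (opI _)).
by apply: funext.
Qed.

(** * Normal forms in free Boolean extensions *)

Section NormalForm.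
Variable L : algebra HSig.

Definition hnf (ps : seq (L * L)) : L :=
  foldr (fun p acc => Hmeet (Himp p.1 p.2) acc) (Htop L) ps.

(** A pair (u, v) stands for the clause -u + v, and a list for the meet of its clauses. The join of
    two clauses is again one: (-u + v) + (-u' + v') = -(u u') + (v + v'). *)
Definition nfj (ps qs : seq (L * L)) : seq (L * L) :=
  [seq (Hmeet p.1 q.1, Hjoin p.2 q.2) | p <- ps, q <- qs].

(** The complement of -u + v is the meet of u = -1 + u and -v = -v + 0; the pair (1, 0) is the
    bottom element. *)
Definition nfc (ps : seq (L * L)) : seq (L * L) :=
  foldr (fun p acc => nfj [:: (Htop L, p.1); (p.2, Hbot L)] acc) [:: (Htop L, Hbot L)] ps.

Hypothesis HL : Mod HA_axioms L.
Variable A : algebra ISig.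
Variable k : L -> A.

Definition nf (ps : seq (L * L)) : A :=
  foldr (fun p acc => Imeet (Ijoin (Icompl (k p.1)) (k p.2)) acc) (Itop A) ps.

Hypothesis IA : Mod IA_axioms A.
Hypothesis kh : is_hom (k : L -> hofi A).

(** Every operation of [hofi A] ends with an interior, and x is a value of an operation, being its
    own meet with itself. *)
Lemma k_open x : Iint (k x) = k x.
Proof.
by rewrite -(lat_mxx (heyting_lattice HL) x) [k _](kh (o := HMeet)) /= Iint_idem.
Qed.

Lemma kM x y : k (Hmeet x y) = Imeet (k x) (k y).
Proof. by rewrite [LHS](kh (o := HMeet)) /= Iint_meet // !k_open. Qed.

Lemma kJ x y : k (Hjoin x y) = Ijoin (k x) (k y).
Proof.
rewrite [LHS](kh (o := HJoin)) /= -[k (args2 _ _ _)]k_open -[X in Ijoin _ X]k_open.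
by rewrite Iint_joinI // !k_open.
Qed.

Lemma kI x y : k (Himp x y) = Iint (Ijoin (Icompl (k x)) (k y)).
Proof. by rewrite [LHS](kh (o := HImp)). Qed.

Lemma k0 : k (Hbot L) = Ibot A.
Proof. by rewrite [LHS](kh (o := HBot)) /= Iint_bot. Qed.

Lemma k1 : k (Htop L) = Itop A.
Proof. by rewrite [LHS](kh (o := HTop)) /= Iint_top. Qed.

Lemma nf_int ps : Iint (nf ps) = k (hnf ps).
Proof.
by elim: ps => [|p ps IH] /=; rewrite ?Iint_top ?k1 // Iint_meet // IH kM kI.
Qed.

Lemma nf_cat ps qs : nf (ps ++ qs) = Imeet (nf ps) (nf qs).
Proof.
elim: ps => [|p ps IH] /=; last by rewrite IH (lat_mA (interior_lattice IA)).
by rewrite (lat_mC (interior_lattice IA)) (lat_m1 (interior_lattice IA)).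
Qed.

Lemma nf_join ps qs : nf (nfj ps qs) = Ijoin (nf ps) (nf qs).
Proof.
elim: ps => [|p ps IH] /=.
  by apply: (bool_ext IA) => F pF; rewrite !(ipE IA pF).
rewrite nf_cat IH.
have -> : nf [seq (Hmeet p.1 q.1, Hjoin p.2 q.2) | q <- qs] =
    Ijoin (Ijoin (Icompl (k p.1)) (k p.2)) (nf qs).
  elim: qs {IH} => [|q qs IH] /=; apply: (bool_ext IA) => F pF; rewrite ?IH ?kM ?kJ !(ipE IA pF).
    by rewrite orbT.
  by case: (F (k p.1)); case: (F (k p.2)); case: (F (k q.1)); case: (F (k q.2)).
apply: (bool_ext IA) => F pF; rewrite !(ipE IA pF).
by case: (F (nf ps)); case: (F (nf qs)); rewrite ?orbT ?andbT ?orbF ?andbF.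
Qed.

Lemma nf_compl ps : nf (nfc ps) = Icompl (nf ps).
Proof.
elim: ps => [|p ps IH]; apply: (bool_ext IA) => F pF.
  by rewrite /= k0 k1 !(ipE IA pF).
rewrite [nfc _]/= nf_join IH /= k0 k1 !(ipE IA pF).
by case: (F (k p.1)); case: (F (k p.2)); case: (F _).
Qed.

Lemma nf_var x : nf [:: (Htop L, x)] = k x.
Proof. by apply: (bool_ext IA) => F pF; rewrite /= k1 !(ipE IA pF) andbT. Qed.

Lemma bool_gen_nf a : bool_gen (fun b => exists x, k x = b) a -> exists ps, a = nf ps.
Proof.
elim=> {a} [a [x <-]|a b _ [ps ->] _ [qs ->]|a b _ [ps ->] _ [qs ->]|a _ [ps ->]||].
- by exists [:: (Htop L, x)]; rewrite nf_var.
- by exists (ps ++ qs); rewrite nf_cat.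
- by exists (nfj ps qs); rewrite nf_join.
- by exists (nfc ps); rewrite nf_compl.
- by exists [:: (Htop L, Hbot L)]; rewrite nf_var k0.
- by exists [::].
Qed.

Lemma nf_gen ps : bool_gen (fun b => exists x, k x = b) (nf ps).
Proof.
elim: ps => [|p ps IH] /=; first exact: bg_top.
have kg x : bool_gen (fun b => exists x, k x = b) (k x) by apply: bg_in; exists x.
by apply: bg_meet => //; apply: bg_join => //; apply: bg_compl.
Qed.

(* In a Kripke frame: a chain x1 <= x2 <= ... can enter and leave a Boolean
   combination of finitely many up-sets only finitely often, whereas nonzero
   p and q would allow an infinite alternation. *)
Lemma nf_no_alternation ps p q :
  ble p (Icl q) -> ble q (Icl p) -> ble p (Icompl (nf ps)) -> ble q (nf ps) ->
  p = Ibot A.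
Proof.
elim: ps p q => [|[x y] ps IH] p q pq qp pn qn.
  by apply: (ble_anti IA) => F pF; [move=> /(pn F pF)|]; rewrite !(ipE IA pF).
move: pn qn => /=; set u := k x; set v := k y => pn qn.
have res (w a b : A) : Iint w = w -> ble a (Icl b) -> ble (Imeet w a) (Icl (Imeet w b)).
  move=> wo ab; apply: (ble_trans (b := Imeet w (Icl b))); last exact: open_meet_Icl.
  by move=> F pF; rewrite !(ptM pF) => /andP[-> /(ab F pF)].
have bot a b : ble a (Icl b) -> b = Ibot A -> a = Ibot A.
  move=> ab b0; apply: (ble_anti IA) => F pF; last by rewrite (pt0 pF).
  by move=> /(ab F pF); rewrite b0 Icl_bot.
have uo := k_open x; have vo := k_open y.
(* Inside the open element [v] the head clause -u + v holds everywhere, so there the remaining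
   clauses alone separate p from q. *)
have vp : Imeet v p = Ibot A.
  apply: (IH _ (Imeet v q) (res _ _ _ vo pq) (res _ _ _ vo qp)).
    move=> F pF; rewrite (ptM pF) => /andP[Fv /(pn F pF)].
    by rewrite !(ipE IA pF) Fv orbT.
  move=> F pF; rewrite (ptM pF) => /andP[Fv /(qn F pF)].
  by rewrite !(ipE IA pF) => /andP[].
have vq : Imeet v q = Ibot A by apply: bot (res _ _ _ vo qp) vp.
have uq : Imeet u q = Ibot A.
  apply: (ble_anti IA) => F pF; last by rewrite (pt0 pF).
  rewrite -vq !(ptM pF) => /andP[Fu Fq]; move: (qn F pF Fq).
  by rewrite !(ipE IA pF) Fu Fq /= => /andP[->].
have up : Imeet u p = Ibot A by apply: bot (res _ _ _ uo pq) uq.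
(* Now p is disjoint from [u], hence satisfies the head clause, and must violate one of the
   remaining clauses. *)
apply: (IH p q) => // F pF H; last by move: (qn F pF H); rewrite (ptM pF) => /andP[].
move: (pn F pF H) (congr1 F up).
by rewrite !(ipE IA pF) H andbT => + Fu; rewrite Fu.
Qed.

End NormalForm.

Lemma nf_hom (L : algebra HSig) (A B : algebra ISig) (k : L -> A) (h : A -> B) ps :
  is_hom h -> h (nf k ps) = nf (fun x => h (k x)) ps.
Proof.
move=> hh; elim: ps => [|p ps IH] /=; first exact: hom_Itop.
by rewrite hom_Imeet // hom_Ijoin // hom_Icompl // IH.
Qed.

Lemma bool_gen_trans (A : algebra ISig) (S P : A -> Prop) (a : A) :
  (forall b, S b -> bool_gen P b) -> bool_gen S a -> bool_gen P a.
Proof.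
move=> SP; elim=> {a} [a /SP //|a b _ ? _ ?|a b _ ? _ ?|a _ ?||].
- exact: bg_meet.
- exact: bg_join.
- exact: bg_compl.
- exact: bg_bot.
- exact: bg_top.
Qed.

(** * Interior algebras generated by their open elements *)

Record BL (L : algebra HSig) (A : algebra ISig) (e : L -> A) : Prop := MkBL {
  BL_ia : Mod IA_axioms A;
  BL_hom : is_hom (e : L -> hofi A);
  BL_inj : injective e;
  BL_gen : forall a, bool_gen (fun b => exists x, e x = b) a }.

(** The interior formula for one clause says that [e] respects implication, and x = (1 => x) then
    makes [e x] open. Conversely, the interior of a normal form is computed clause by clause,
    because the interior preserves meets. *)
Lemma is_BLP (L : algebra HSig) (A : algebra ISig) :
  Mod HA_axioms L -> is_BL L A <-> exists e : L -> A, BL e.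
Proof.
move=> HL; split=> [[IA [e [eI eMJ [e0 e1] eG eint]]]|[e [IA eh eI eG]]]; last first.
  split=> //; exists e; split=> //.
  - by move=> x y; rewrite kM // kJ.
  - by rewrite k0 // k1.
  - by move=> ps; rewrite -/(hnf ps) -nf_int.
have eI1 x y : Iint (Ijoin (Icompl (e x)) (e y)) = e (Himp x y).
  have := eint [:: (x, y)].
  by rewrite /= (lat_m1 (interior_lattice IA)) (lat_m1 (heyting_lattice HL)).
have eo x : Iint (e x) = e x.
  rewrite -[in RHS](Himp1x HL x) -eI1 e1; congr Iint.
  by apply: (bool_ext IA) => F pF; rewrite !(ipE IA pF).
exists e; split=> // -[] args.
- by rewrite (args2E args) -/(Hmeet _ _) /= -(eMJ _ _).1 eo.
- by rewrite (args2E args) -/(Hjoin _ _) /= -(eMJ _ _).2 eo.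
- by rewrite (args2E args) -/(Himp _ _) /= eI1.
- by rewrite (args0E args) -/(Hbot _) /= -e0 eo.
- by rewrite (args0E args) -/(Htop _) /= -e1 eo.
Qed.

Section BLTheory.
Variables (L : algebra HSig) (A : algebra ISig) (e : L -> A).
Hypotheses (HL : Mod HA_axioms L) (eBL : BL e).

Lemma BL_nf a : exists ps, a = nf e ps.
Proof. exact: (bool_gen_nf HL (BL_ia eBL) (BL_hom eBL) (BL_gen eBL a)). Qed.

(** Together with [k_open], this identifies the open elements with the image of [e]. *)
Lemma BL_int a : exists x, e x = Iint a.
Proof.
have [ps ->] := BL_nf a.
by exists (hnf ps); rewrite (nf_int HL (BL_ia eBL) (BL_hom eBL)).
Qed.

Lemma BL_hom_ext (B : algebra ISig) (f g : A -> B) :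
  is_hom f -> is_hom g -> (forall x, f (e x) = g (e x)) -> f =1 g.
Proof.
move=> fh gh fg a.
elim: (BL_gen eBL a) => {a} [a [x <-] //|a b _ fa _ fb|a b _ fa _ fb|a _ fa||].
- by rewrite !hom_Imeet // fa fb.
- by rewrite !hom_Ijoin // fa fb.
- by rewrite !hom_Icompl // fa.
- by rewrite !hom_Ibot.
- by rewrite !hom_Itop.
Qed.

(** The extension is computed on normal forms. It is well defined because a normal form equal to top
    has interior top, so [hnf] of it is top in L; applying [k], the interior of its image, hence the
    image itself, is top. *)
Lemma BL_extend (B : algebra ISig) (k : L -> B) :
  Mod IA_axioms B -> is_hom (k : L -> hofi B) ->
  exists h : A -> B, is_hom h /\ forall x, h (e x) = k x.
Proof.
move=> IB kh; have IA := BL_ia eBL; have eh := BL_hom eBL.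
have nf1 ps : nf e ps = Itop A -> nf k ps = Itop B.
  move=> ps1; have : hnf ps = Htop L.
    by apply: (BL_inj eBL); rewrite -nf_int // ps1 k1 // Iint_top.
  move=> /(congr1 k); rewrite -nf_int // k1 // => ps1'.
  apply: (ble_anti IB) => F pF; first by rewrite (pt1 pF).
  by rewrite -ps1'; apply: (Iint_le IB).
(* An equality is reduced to [nf1] through the normal form of the biconditional of its two sides. *)
have nf_eq ps qs : nf e ps = nf e qs -> nf k ps = nf k qs.
  move=> pq; have := @nf1 (nfj (nfc ps) qs ++ nfj ps (nfc qs)).
  rewrite !nf_cat // !nf_join // !nf_compl // pq => /(_ _) H.
  have {}H := H ltac:(by apply: (bool_ext IA) => F pF; rewrite !(ipE IA pF); case: (F _)).
  apply: (bool_ext IB) => F pF; move: (congr1 F H); rewrite !(ipE IB pF).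
  by case: (F (nf k ps)); case: (F (nf k qs)).
have [p pE] := choice BL_nf.
pose h a := nf k (p a).
have hE ps : h (nf e ps) = nf k ps by apply: nf_eq; rewrite -pE.
have he x : h (e x) = k x by rewrite -(nf_var IA eh) hE nf_var.
exists h; split=> // -[] args.
- rewrite [args]args2E args2_comp -!/(Imeet _ _).
  by rewrite (pE (args ord0)) (pE (args ord_max)) !hE -!nf_cat.
- rewrite [args]args2E args2_comp -!/(Ijoin _ _).
  by rewrite (pE (args ord0)) (pE (args ord_max)) !hE -!nf_join.
- rewrite [args]args1E -[interp A _ _]/(Icompl (args ord0)).
  rewrite -[RHS]/(Icompl (h (args ord0))).
  by rewrite (pE (args ord0)) hE -!nf_compl.
- rewrite [args]args0E [X in interp B _ X]args0E -!/(Ibot _).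
  by rewrite -(k0 IA eh) he (k0 IB kh).
- rewrite [args]args0E [X in interp B _ X]args0E -!/(Itop _).
  by rewrite -(k1 IA eh) he (k1 IB kh).
- rewrite [args]args1E -[interp A _ _]/(Iint (args ord0)).
  rewrite -[RHS]/(Iint (h (args ord0))).
  by rewrite (pE (args ord0)) hE !nf_int.
Qed.

End BLTheory.

(** A homomorphism of interior algebras sends open elements to open elements, and [e'] is a
    bijection onto those of A'. *)
Lemma BL_restrict (L L' : algebra HSig) (A A' : algebra ISig) (e : L -> A) (e' : L' -> A')
    (h : A -> A') :
  Mod HA_axioms L -> Mod HA_axioms L' -> BL e -> BL e' -> is_hom h ->
  exists f : L -> L', is_hom f /\ forall x, e' (f x) = h (e x).
Proof.
move=> HL HL' eB eB' hh.
have [|f fE] := @choice _ _ (fun x y => e' y = h (e x)).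
  move=> x; have [y yE] := BL_int HL' eB' (h (e x)); exists y.
  by rewrite yE -hom_Iint // (k_open HL (BL_ia eB) (BL_hom eB)).
exists f; split=> // o args; apply: (BL_inj eB').
rewrite fE (BL_hom eB) (hofi_hom hh) (BL_hom eB'); congr (interp (hofi A') o _).
by apply: funext => i; rewrite fE.
Qed.

(** * Grzegorczyk's identity *)

Definition icl {X} (s : term ISig X) : term ISig X := icompl (iint (icompl s)).

(** This is the modal axiom []([](x -> []x) -> x) -> x taken at the complement of x and rewritten
    with the closure: no point of x starts an endless alternation between x and its complement. *)
Definition grz : equation ISig :=
  (imeet ix (iint (ijoin (icompl ix) (icl (imeet (icl ix) (icompl ix))))), ibot).

Definition grz_law (A : algebra ISig) : Prop := forall p : A,
  Imeet p (Iint (Ijoin (Icompl p) (Icl (Imeet (Icl p) (Icompl p))))) = Ibot A.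

Lemma grzE (A : algebra ISig) : satisfies A grz <-> grz_law A.
Proof.
split=> [H p|H v]; last by rewrite /grz /icl /fst /snd !eval_iE; apply: H.
by have := H (fun=> p); rewrite /grz /icl /fst /snd !eval_iE.
Qed.

(** Inside the open element [a], the elements p and cl(p) - p lie in each other's closure, while a
    normal form of the complement of p separates them; [nf_no_alternation] makes the part of p in
    [a] vanish. *)
Lemma BL_grz (L : algebra HSig) (A : algebra ISig) (e : L -> A) :
  Mod HA_axioms L -> BL e -> grz_law A.
Proof.
move=> HL eB p; have IA := BL_ia eB; set a := Iint _.
have ao : Iint a = a by apply: Iint_idem.
have [ps psE] := BL_nf HL eB (Icompl p).
rewrite (lat_mC (interior_lattice IA)).
apply: (nf_no_alternation HL IA (BL_hom eB) (ps := ps)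
          (q := Imeet a (Imeet (Icl p) (Icompl p)))).
- apply: (ble_trans (b := Imeet a (Icl (Imeet (Icl p) (Icompl p))))); last exact: open_meet_Icl.
  move=> F pF; rewrite !(ptM pF) => /andP[Fa Fp]; rewrite Fa /=.
  by move: (Iint_le IA pF Fa); rewrite (ptJ pF) (ptC _ _ pF) // Fp.
- apply: (ble_trans (b := Imeet a (Icl p))); last exact: open_meet_Icl.
  by move=> F pF; rewrite !(ptM pF) => /and3P[-> ->].
- by move=> F pF; rewrite -psE !(ipE IA pF) negbK => /andP[].
- by move=> F pF; rewrite -psE !(ptM pF) => /and3P[].
Qed.

Section FiniteGrz.
Variable A : algebra ISig.
Hypotheses (IA : Mod IA_axioms A) (fA : is_finite A).

Lemma finite_join (P : A -> Prop) : exists j,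
  bool_gen P j /\ forall F, ipoint F -> F j <-> exists2 x, P x & F x.
Proof.
have [s sP] := fA.
suff [j [jg jP]] : exists j, bool_gen P j /\
    forall F, ipoint F -> F j <-> exists x, [/\ List.In x s, P x & F x].
  exists j; split=> // F pF; rewrite jP //.
  by split=> [[x [_ Px Fx]]|[x Px Fx]]; exists x.
elim: s {sP} => [|a s [j [jg jP]]].
  exists (Ibot A); split=> [|F pF]; first exact: bg_bot.
  by rewrite (pt0 pF); split=> // -[x []].
have [Pa|nPa] := pselect (P a); last first.
  exists j; split=> // F pF; rewrite jP //.
  split=> -[x [sx Px Fx]]; exists x; split=> //; first by right.
  by case: sx => // ax; exfalso; apply: nPa; rewrite ax.
exists (Ijoin a j); split=> [|F pF]; first by apply: bg_join => //; apply: bg_in.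
rewrite (ptJ pF); split=> [/orP[Fa|/jP]|[x [[ax|sx] Px Fx]]].
- by exists a; split=> //; left.
- by case=> // x [sx Px Fx]; exists x; split=> //; right.
- by rewrite ax Fx.
- by apply/orP; right; apply/jP => //; exists x.
Qed.

Lemma finite_meet (P : A -> Prop) : exists w,
  ((forall x, P x -> Iint x = x) -> Iint w = w) /\
  forall F, ipoint F -> F w <-> forall x, P x -> F x.
Proof.
have [s sP] := fA.
suff [w [wo wP]] : exists w, ((forall x, P x -> Iint x = x) -> Iint w = w) /\
    forall F, ipoint F -> F w <-> forall x, List.In x s -> P x -> F x.
  exists w; split=> // F pF; rewrite wP //.
  by split=> [H x Px|H x _ Px]; apply: H.
elim: s {sP} => [|a s [w [wo wP]]].
  exists (Itop A); split=> [_|F pF]; first exact: Iint_top.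
  by rewrite (pt1 pF).
have [Pa|nPa] := pselect (P a); last first.
  exists w; split=> // F pF; rewrite wP //; split=> H x sx Px; apply: H => //.
    by case: sx => // ax; exfalso; apply: nPa; rewrite ax.
  by right.
exists (Imeet a w); split=> [Po|F pF]; first by rewrite Iint_meet // wo // Po.
rewrite (ptM pF); split=> [/andP[Fa /wP H] x [<- //|sx] Px|H]; first exact: H.
apply/andP; split; first by apply: H => //; left.
by apply/wP => // x sx Px; apply: H => //; right.
Qed.

Hypothesis grzA : grz_law A.

Lemma grz_elim (p : A) : ble p (Icl (Imeet (Icl p) (Icompl p))) -> p = Ibot A.
Proof.
move=> H; rewrite -(grzA p).
have -> : Ijoin (Icompl p) (Icl (Imeet (Icl p) (Icompl p))) = Itop A.
  apply: (bool_ext IA) => F pF; rewrite (ptJ pF) (ptC IA _ pF) (pt1 pF).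
  by case: (boolP (F p)) => //= /(H F pF).
by rewrite Iint_top // (lat_m1 (interior_lattice IA)).
Qed.

(* m is the atom generating the ultrafilter F, w the least open element above m.
   Grzegorczyk's identity forces w - m to be open, so m = w - (w - m). *)
Lemma grz_atom (F : A -> bool) : ipoint F ->
  exists m, [/\ bool_gen (fun b => Iint b = b) m, F m &
                forall G, ipoint G -> G m -> G =1 F].
Proof.
move=> pF; have [m [_ mP]] := finite_meet F.
have Fm : F m by apply/mP.
have mF G : ipoint G -> G m -> G =1 F.
  move=> pG /(mP _ pG) GF x; case: (boolP (F x)) => [/GF //|].
  by rewrite -(ptC IA _ pF) => /GF; rewrite (ptC IA _ pG) => /negbTE.
have [w [/(_ (fun x H => H.1)) wo wP]] := finite_meet (fun x => Iint x = x /\ F x).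
have mw : ble m w by move=> G pG /(mF _ pG) GF; apply/wP => // x [_]; rewrite GF.
(* The part of w - m that touches the closure of m, which is what could keep w - m from being
   open. *)
pose p := Imeet (Imeet w (Icompl m)) (Icl m).
have p0 : p = Ibot A.
  (* If the atom m lies in cl(p), it lies in cl(p) - p, so p, being below cl(m), falls to
     [grz_elim]. Otherwise [F] contains the open element [Iint (Icompl p)], which is then above w,
     whereas p is below w. *)
  have [Fp|nFp] := boolP (F (Icl p)).
    apply: grz_elim; apply: (ble_trans (b := Icl m)).
      by move=> G pG; rewrite (ptM pG) => /andP[].
    apply: (Icl_mono IA) => G pG Gm.
    by rewrite (ptM pG) (mF _ pG Gm) Fp /= !(ipE IA pG) Gm andbF.
  apply: (ble_anti IA) => G pG; last by rewrite (pt0 pG).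
  move=> Gp; have Gw : G w by move: Gp; rewrite !(ptM pG) => /andP[/andP[]].
  have : G (Iint (Icompl p)).
    move/(wP _ pG): Gw; apply; split; first exact: Iint_idem.
    by move: nFp; rewrite (ptC IA _ pF) negbK.
  by move=> /(Iint_le IA pG); rewrite (ptC IA _ pG) Gp.
(* As p vanishes, w - m misses cl(m), so it lies below the interior of the complement of m. *)
have wmo : Iint (Imeet w (Icompl m)) = Imeet w (Icompl m).
  apply: (ble_anti IA); first exact: Iint_le.
  move=> G pG Gwm; rewrite Iint_meet // wo.
  move: (congr1 G p0); rewrite (pt0 pG) [G p](ptM pG) Gwm /= (ptC IA _ pG) => /negbFE Gi.
  by move: Gwm; rewrite !(ptM pG) Gi => /andP[-> _].
exists m; split=> //.
have -> : m = Imeet w (Icompl (Imeet w (Icompl m))).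
  apply: (bool_ext IA) => G pG; rewrite !(ipE IA pG).
  by have := mw G pG; case: (G m); case: (G w) => // /(_ isT).
by apply: bg_meet; [|apply: bg_compl]; apply: bg_in.
Qed.

(** [a] is the join of the generated elements below it: an ultrafilter containing [a] contains its
    own atom, which is generated and lies below [a]. *)
Lemma finite_grz_open_gen (a : A) : bool_gen (fun b => Iint b = b) a.
Proof.
have [j [jg jP]] := finite_join (fun b => bool_gen (fun b => Iint b = b) b /\ ble b a).
suff -> : a = j by apply: bool_gen_trans jg => b [].
apply: (ble_anti IA) => F pF; last by move=> /(jP _ pF) [b [_ ba]]; apply: ba.
move=> Fa; apply/jP => //; have [m [mg Fm mF]] := grz_atom pF.
by exists m => //; split=> // G pG /(mF _ pG) ->.
Qed.

End FiniteGrz.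

(** * Open elements *)

Section Rho.
Variable A : algebra ISig.
Hypothesis IA : Mod IA_axioms A.

Lemma open_closed : @closed_under _ (hofi A) (fun x => Iint x = x).
Proof. by move=> o args _; apply: Iint_idem. Qed.

Definition rho : algebra HSig := subalg open_closed.

Definition rho_val (x : rho) : A := sval x.

Lemma rho_BL : (forall a : A, bool_gen (fun b => Iint b = b) a) -> BL rho_val.
Proof.
move=> gA; split=> //; first by move=> x y; apply: sval_inj.
move=> a; apply: bool_gen_trans (gA a) => b bo; apply: bg_in.
by exists (exist (fun x : A => Iint x = x) b bo).
Qed.

End Rho.

Lemma HVariety_HA E L : HVariety E L -> Mod HA_axioms L.
Proof. by move=> VL e He; apply: VL; left. Qed.

Lemma BL_rho_star E (L : algebra HSig) (A : algebra ISig) (e : L -> A) :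
  HVariety E L -> BL e -> rho_star E A.
Proof.
move=> VL eB eq /(_ L A VL); apply.
by apply/is_BLP; [apply: HVariety_HA VL|exists e].
Qed.

Lemma rho_star_IA E A : rho_star E A -> Mod IA_axioms A.
Proof. by move=> WA e He; apply: WA => L B _ [IB _]; apply: IB. Qed.

Lemma rho_star_grz E A : rho_star E A -> grz_law A.
Proof.
move=> WA; apply/grzE; apply: WA => L B VL /(is_BLP _ (HVariety_HA VL)) [e eB].
by apply/grzE; apply: BL_grz eB; apply: HVariety_HA VL.
Qed.

(** The translation of an identity of [HVariety E] holds in every B(L), because there interiors are
    values of [e]. So it holds in A, and at open arguments it evaluates to the original identity. *)
Lemma rho_HVariety E A (WA : rho_star E A) : HVariety E (rho (rho_star_IA WA)).
Proof.
move=> [s t] st v.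
have {st} gst : rho_star_eqs E (godel s, godel t).
  move=> L B VL /(is_BLP _ (HVariety_HA VL)) [e eB] w; rewrite /= !eval_godel.
  have [w' w'E] := choice (fun n => BL_int (HVariety_HA VL) eB (w n)).
  have -> : (fun n => Iint (w n)) = (fun n => e (w' n)) by apply: funext.
  by rewrite -!(eval_hom _ _ (BL_hom eB)); congr e; apply: (VL _ st).
apply: sval_inj; have := WA _ gst (fun n => sval (v n)); rewrite /= !eval_godel.
have -> : (fun n => Iint (sval (v n))) = (fun n => sval (v n)).
  by apply: funext => n; apply: svalP (v n).
by rewrite -!(eval_hom _ _ (sval_hom _)).
Qed.

Arguments rho_HVariety [E A] WA.

(** * The free Boolean extension of a Heyting algebra *)

(** The Boolean subalgebra generated by the image of [k] is closed under the interior, since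
    [nf_int] puts the interior of a normal form into that image. *)
Lemma bool_gen_BL (L : algebra HSig) (P : algebra ISig) (k : L -> P) :
  Mod HA_axioms L -> Mod IA_axioms P -> is_hom (k : L -> hofi P) -> injective k ->
  exists (A : algebra ISig) (e : L -> A), BL e.
Proof.
move=> HL IP kh kI.
pose S := bool_gen (fun b : P => exists x, k x = b).
have cS : closed_under S.
  move=> -[] args Sa.
  - by rewrite (args2E args); exact: (bg_meet (Sa ord0) (Sa ord_max)).
  - by rewrite (args2E args); exact: (bg_join (Sa ord0) (Sa ord_max)).
  - by rewrite (args1E args); exact: (bg_compl (Sa ord0)).
  - by rewrite (args0E args); exact: bg_bot.
  - by rewrite (args0E args); exact: bg_top.
  - rewrite (args1E args) -/(Iint _).
    have [ps ->] := bool_gen_nf HL IP kh (Sa ord0).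
    by rewrite nf_int //; apply: bg_in; exists (hnf ps).
have kS x : S (k x) by apply: bg_in; exists x.
pose e x : subalg cS := exist _ (k x) (kS x).
have vh := hofi_hom (sval_hom cS).
have eh : is_hom (e : L -> hofi (subalg cS)).
  by move=> o args; apply: sval_inj; rewrite vh /= kh.
exists (subalg cS), e; split=> //.
- exact: Mod_subalg.
- by move=> x y /(congr1 sval) /kI.
- move=> [a Sa]; have [ps aE] := bool_gen_nf HL IP kh Sa.
  have -> : exist _ a Sa = nf e ps; last exact: nf_gen.
  by apply: sval_inj; rewrite (nf_hom _ _ (sval_hom cS)).
Qed.

Section PrimeSpectrum.
Variable L : algebra HSig.
Hypothesis HL : Mod HA_axioms L.

Let X := {F : L -> bool | hpoint F}.

Definition spec_le (x y : X) : Prop := forall z, sval x z -> sval y z.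

(** The power set of the prime filters ordered by inclusion; the interior of a set is the largest
    up-set inside it. *)
Definition spec_pow : algebra ISig := @Algebra ISig (X -> bool) (fun o =>
  match o return ('I_(@arity ISig o) -> X -> bool) -> X -> bool with
  | IMeet => fun a x => a ord0 x && a ord_max x
  | IJoin => fun a x => a ord0 x || a ord_max x
  | ICompl => fun a x => ~~ a ord0 x
  | IBot => fun _ _ => false
  | ITop => fun _ _ => true
  | IInt => fun a x => `[< forall y, spec_le x y -> a ord0 y >]
  end).

Lemma spec_pow_IA : Mod IA_axioms spec_pow.
Proof.
have sM (a b : spec_pow) x : Imeet a b x = a x && b x by [].
have sJ (a b : spec_pow) x : Ijoin a b x = a x || b x by [].
have sC (a : spec_pow) x : Icompl a x = ~~ a x by [].
have s0 x : Ibot spec_pow x = false by [].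
have s1 x : Itop spec_pow x = true by [].
have sI (a : spec_pow) x : Iint a x = `[< forall y, spec_le x y -> a y >] by [].
move=> e; rewrite /IA_axioms /=.
(* The first eleven axioms are the Boolean ones and are checked by truth tables at each point; the
   four that follow concern the interior. *)
do 11!(case=> [<- v|]; first by rewrite /fst /snd !eval_iE;
  apply: funext => x; rewrite !(sM, sJ, sC, s0, s1);
  case: (eval v ix x); case: (eval v iy x); case: (eval v iz x)).
case=> [<- v|]; first rewrite /fst /snd !eval_iE.
  by apply: funext => x; apply/asboolP.
case=> [<- v|]; first rewrite /fst /snd !eval_iE.
  apply: funext => x; rewrite sM !sI; apply/asboolP/andP.
    by move=> H; split; apply/asboolP => y /H; rewrite sM => /andP[].
  by move=> [/asboolP H1 /asboolP H2] y xy; rewrite sM H1 // H2.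
case=> [<- v|]; first rewrite /fst /snd !eval_iE.
  apply: funext => x; rewrite sM; apply/andP/idP => [[]//|H].
  by split=> //; move: H; rewrite sI => /asboolP; apply.
case=> [<- v|//]; rewrite /fst /snd !eval_iE.
apply: funext => x; rewrite !sI; apply/asboolP/asboolP => H y xy.
  by have := H y xy; rewrite sI => /asboolP; apply.
by rewrite sI; apply/asboolP => z yz; apply: H => u /xy /yz.
Qed.

Definition spec_map (u : L) : spec_pow := fun x => sval x u.

Lemma spec_int_up (S : spec_pow) :
  (forall x y, spec_le x y -> S x -> S y) -> Iint S = S.
Proof.
move=> up; apply: funext => x; apply/asboolP/idP => [H|Sx y xy]; first exact: H.
exact: up Sx.
Qed.

Lemma spec_map_hom : is_hom (spec_map : L -> hofi spec_pow).
Proof.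
move=> -[] args; last 2 first.
- rewrite (args0E args) -/(Hbot L) [RHS]spec_int_up //.
  by apply: funext => x; apply: pt0 (svalP x).
- rewrite (args0E args) -/(Htop L) [RHS]spec_int_up //.
  by apply: funext => x; apply: pt1 (svalP x).
- rewrite (args2E args) -/(Hmeet _ _) [RHS]spec_int_up.
    by apply: funext => x; apply: ptM (svalP x) _ _.
  by move=> x y xy /andP[/xy ? /xy ?]; apply/andP.
- rewrite (args2E args) -/(Hjoin _ _) [RHS]spec_int_up.
    by apply: funext => x; apply: ptJ (svalP x) _ _.
  by move=> x y xy /orP[/xy ?|/xy ?]; apply/orP; [left|right].
- rewrite (args2E args) -/(Himp _ _); apply: funext => x.
  apply/idP/asboolP => [/(hpoint_imp HL _ _ (svalP x)) H y xy|H].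
    change (~~ sval y (args ord0) || sval y (args ord_max)); rewrite -implybE.
    by apply/implyP; apply: H (svalP y) xy.
  apply/(hpoint_imp HL _ _ (svalP x)) => G pG xG.
  have : ~~ G (args ord0) || G (args ord_max) by exact: (H (exist _ G pG) xG).
  by rewrite -implybE => /implyP.
Qed.

Lemma BL_exists : exists (A : algebra ISig) (e : L -> A), BL e.
Proof.
apply: (bool_gen_BL HL spec_pow_IA spec_map_hom) => u v uv.
apply: (point_ext (heyting_lattice HL) (heyting_distr HL)) => F pF.
by have /(congr1 (fun f => f (exist _ F pF))) := uv.
Qed.

End PrimeSpectrum.

(** * Comparison of the two varieties *)

Lemma is_finite_hop : is_finite (op_sym HSig).
Proof. by exists [:: HMeet; HJoin; HImp; HBot; HTop] => -[]; simpl; tauto. Qed.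

Lemma is_finite_iop : is_finite (op_sym ISig).
Proof. by exists [:: IMeet; IJoin; ICompl; IBot; ITop; IInt] => -[]; simpl; tauto. Qed.

(** Elements of L are reached by Gödel translations of their terms, and the rest of A by Boolean
    operations. This carries local finiteness from [rho_star E] down to [HVariety E]. *)
Lemma BL_fin_generated (L : algebra HSig) (A : algebra ISig) (e : L -> A) :
  Mod HA_axioms L -> BL e -> fin_generated L -> fin_generated A.
Proof.
move=> HL eB [X [a [fX ga]]]; exists X, (fun x => e (a x)); split=> //.
move=> y; elim: (BL_gen eB y) => {y} [_ [x <-]|b c _ [s <-] _ [t <-]|b c _ [s <-] _ [t <-]
  |b _ [s <-]||].
- have [t <-] := ga x; exists (godel t).
  rewrite eval_godel (eval_hom _ _ (BL_hom eB)).
  have -> // : (fun z => Iint (e (a z))) = (fun z => e (a z)).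
  by apply: funext => z; apply: (k_open HL (BL_ia eB) (BL_hom eB)).
- by exists (imeet s t); rewrite eval_imeet.
- by exists (ijoin s t); rewrite eval_ijoin.
- by exists (icompl s).
- by exists ibot; rewrite eval_ibot.
- by exists itop; rewrite eval_itop.
Qed.

Section Comparison.
Variable E : equation HSig -> Prop.
Hypothesis lfW : locally_finite (rho_star E).

Let V := HVariety E.
Let W := rho_star E.
Let VH L (VL : V L) : Mod HA_axioms L := HVariety_HA VL.
Let WI A (WA : W A) : Mod IA_axioms A := rho_star_IA WA.

Lemma BL_in_W L : V L -> exists (A : algebra ISig) (e : L -> A), BL e /\ W A.
Proof.
move=> VL; have [A [e eB]] := BL_exists (VH VL).
by exists A, e; split=> //; apply: BL_rho_star eB.
Qed.

Lemma locally_finite_HVariety : locally_finite V.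
Proof.
move=> L VL gL; have [A [e [eB WA]]] := BL_in_W VL.
apply: (is_finite_inj (BL_inj eB)); apply: lfW => //.
exact: (BL_fin_generated (VH VL) eB).
Qed.

Lemma BL_finite (L : algebra HSig) (A : algebra ISig) (e : L -> A) :
  V L -> W A -> BL e -> is_finite L <-> is_finite A.
Proof.
move=> VL WA eB; split; last exact: is_finite_inj (BL_inj eB).
move=> fL; apply: lfW => //; apply: (BL_fin_generated (VH VL) eB).
by exists L, id; split=> //; apply: generated_self.
Qed.

Lemma finite_BL_of_W A : W A -> is_finite A ->
  exists (L : algebra HSig) (e : L -> A), [/\ V L, is_finite L & BL e].
Proof.
move=> WA fA; have VL := rho_HVariety WA.
have eB : BL (@rho_val A (WI WA)).
  by apply: rho_BL; apply: finite_grz_open_gen => //; [apply: WI|apply: rho_star_grz WA].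
by exists (rho (WI WA)), (@rho_val A (WI WA)); split=> //; apply/(BL_finite VL WA eB).
Qed.

Lemma finite_BL_of_V L : V L -> is_finite L ->
  exists (A : algebra ISig) (e : L -> A), [/\ W A, is_finite A & BL e].
Proof.
move=> VL fL; have [A [e [eB WA]]] := BL_in_W VL.
by exists A, e; split=> //; apply/(BL_finite VL WA eB).
Qed.

(** Lifting problems between finite algebras are carried across by [BL_restrict] and [BL_extend];
    what remains to be checked is that surjections stay surjective. *)
Lemma BL_projective (L : algebra HSig) (A : algebra ISig) (e : L -> A) :
  V L -> W A -> is_finite L -> is_finite A -> BL e -> projective V L <-> projective W A.
Proof.
move=> VL WA fL fA eB; rewrite (fin_projectiveP locally_finite_HVariety VL fL).
rewrite (fin_projectiveP lfW WA fA); split=> P.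
- move=> B C WB WC fB fC f fh fs g gh.
  have [M [eM [VM fM MB]]] := finite_BL_of_W WB fB.
  have [N [eN [VN fN NB]]] := finite_BL_of_W WC fC.
  have [f' [f'h f'E]] := BL_restrict (VH VM) (VH VN) MB NB fh.
  have [g' [g'h g'E]] := BL_restrict (VH VL) (VH VN) eB NB gh.
  have [|h' [h'h h'E]] := P _ _ VM VN fM fN f' f'h _ g' g'h.
    (* A preimage of an open element need not be open, but its interior is also a preimage. *)
    move=> y; have [b bE] := fs (eN y); have [x xE] := BL_int (VH VM) MB b.
    exists x; apply: (BL_inj NB); rewrite f'E xE hom_Iint // bE.
    exact: (k_open (VH VN) (BL_ia NB) (BL_hom NB)).
  have [||h [hh hE]] := @BL_extend _ _ _ (VH VL) eB B (fun x => eM (h' x)).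
  - exact: WI.
  - exact: (is_hom_comp h'h (BL_hom MB)).
  exists h; split=> //; apply: (BL_hom_ext eB (is_hom_comp hh fh) gh) => x /=.
  by rewrite hE -f'E h'E g'E.
- move=> M N VM VN fM fN f fh fs g gh.
  have [B [eM [WB fB MB]]] := finite_BL_of_V VM fM.
  have [C [eN [WC fC NB]]] := finite_BL_of_V VN fN.
  have ext (K K' : algebra HSig) (D D' : algebra ISig) (k : K -> D) (k' : K' -> D')
      (l : K -> K') : V K -> W D' -> BL k -> BL k' -> is_hom l ->
      exists h : D -> D', is_hom h /\ forall x, h (k x) = k' (l x).
    move=> VK WD' kB k'B lh; apply: (BL_extend (VH VK) kB); first exact: WI.
    exact: (is_hom_comp lh (BL_hom k'B)).
  have [f' [f'h f'E]] := ext _ _ _ _ _ _ _ VM WC MB NB fh.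
  have [g' [g'h g'E]] := ext _ _ _ _ _ _ _ VL WC eB NB gh.
  have [|h' [h'h h'E]] := P _ _ WB WC fB fC f' f'h _ g' g'h.
    (* The image of [f'] is closed under the Boolean operations and contains the generators
       [eN y]. *)
    move=> y; elim: (BL_gen NB y) => {y} [_ [y <-]|b c _ [s <-] _ [t <-]
      |b c _ [s <-] _ [t <-]|b _ [s <-]||].
    + by have [x <-] := fs y; exists (eM x); rewrite f'E.
    + by exists (Imeet s t); rewrite hom_Imeet.
    + by exists (Ijoin s t); rewrite hom_Ijoin.
    + by exists (Icompl s); rewrite hom_Icompl.
    + by exists (Ibot B); rewrite hom_Ibot.
    + by exists (Itop B); rewrite hom_Itop.
  have [h [hh hE]] := BL_restrict (VH VL) (VH VM) eB MB h'h.
  exists h; split=> // x; apply: (BL_inj NB).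
  by rewrite -f'E hE h'E g'E.
Qed.

(** * Correspondence of unifiers *)

Definition BL_unifier (L : algebra HSig) (A : algebra ISig) (e : L -> A)
  (U : unifier V L) (U' : unifier W A) : Prop :=
  exists2 e' : u_alg U -> u_alg U', BL e' & forall x, u_map U' (e x) = e' (u_map U x).

Section BLUnifiers.
Variables (L : algebra HSig) (A : algebra ISig) (e : L -> A).
Hypotheses (VL : V L) (WA : W A) (eB : BL e).

Lemma BL_unifier_l U : exists U', BL_unifier e U U'.
Proof.
case: U => M u uh Mfp Mp; have fM := fin_presented_finite locally_finite_HVariety Mfp.
have VM := Mp.1; have [B [e' [WB fB e'B]]] := finite_BL_of_V VM fM.
have [h [hh hE]] :=
  BL_extend (VH VL) eB (WI WB) (is_hom_comp uh (BL_hom e'B)).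
have Bfp := finite_fin_presented is_finite_iop WB fB.
have Bp : projective W B by apply/(BL_projective VM WB fM fB e'B).
by exists (Unifier hh Bfp Bp), e'.
Qed.

Lemma BL_unifier_r U' : exists U, BL_unifier e U U'.
Proof.
case: U' => B u uh Bfp Bp; have fB := fin_presented_finite lfW Bfp.
have WB := Bp.1; have [M [e' [VM fM e'B]]] := finite_BL_of_W WB fB.
have [f [fh fE]] := BL_restrict (VH VL) (VH VM) eB e'B uh.
have Mfp := finite_fin_presented is_finite_hop VM fM.
have Mp : projective V M by apply/(BL_projective VM WB fM fB e'B).
by exists (Unifier fh Mfp Mp), e'.
Qed.

(** Comparison maps are extended or restricted between the codomains. The triangle over A needs
    checking only on the image of [e], which generates A; the one over L follows from injectivity of
    [e2]. *)
Lemma BL_unifier_more_general U1 U2 U1' U2' :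
  BL_unifier e U1 U1' -> BL_unifier e U2 U2' ->
  more_general U1 U2 <-> more_general U1' U2'.
Proof.
move=> [e1 e1B e1E] [e2 e2B e2E].
have V1 : V (u_alg U1) := (u_proj U1).1.
have V2 : V (u_alg U2) := (u_proj U2).1.
have W2 : W (u_alg U2') := (u_proj U2').1.
split=> [[f [fh fE]]|[h [hh hE]]].
- have [h [hh hE]] := BL_extend (VH V1) e1B (WI W2) (is_hom_comp fh (BL_hom e2B)).
  exists h; split=> //.
  apply: (BL_hom_ext eB (@u_hom _ _ _ U2') (is_hom_comp (@u_hom _ _ _ U1') hh)) => x /=.
  by rewrite e1E hE e2E fE.
- have [f [fh fE]] := BL_restrict (VH V1) (VH V2) e1B e2B hh.
  by exists f; split=> // x; apply: (BL_inj e2B); rewrite fE -e1E -e2E.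
Qed.

Lemma BL_same_types : same_types V W L A.
Proof.
split.
- split=> [[U]|[U']].
    by have [U' _] := BL_unifier_l U; apply: inhabits.
  by have [U _] := BL_unifier_r U'; apply: inhabits.
- move=> I; split=> -[M].
    exact: mu_set_transfer BL_unifier_l BL_unifier_r BL_unifier_more_general.
  apply: (mu_set_transfer BL_unifier_r BL_unifier_l) => U1 U2 U1' U2' H1 H2.
  by apply: iff_sym; apply: BL_unifier_more_general.
Qed.

End BLUnifiers.

Lemma same_types_of_V L : fin_presented V L ->
  exists A, fin_presented W A /\ same_types V W L A.
Proof.
move=> Lfp; have VL := Lfp.1; have fL := fin_presented_finite locally_finite_HVariety Lfp.
have [A [e [WA fA eB]]] := finite_BL_of_V VL fL.
exists A; split; first exact: finite_fin_presented is_finite_iop WA fA.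
exact: BL_same_types eB.
Qed.

Lemma same_types_of_W A : fin_presented W A ->
  exists L, fin_presented V L /\ same_types V W L A.
Proof.
move=> Afp; have WA := Afp.1; have fA := fin_presented_finite lfW Afp.
have [L [e [VL fL eB]]] := finite_BL_of_W WA fA.
exists L; split; first exact: finite_fin_presented is_finite_hop VL fL.
exact: BL_same_types eB.
Qed.

End Comparison.

Theorem theorem5p8 (E : equation HSig -> Prop) :
  locally_finite (rho_star E) ->
  forall k : unif_type,
    variety_type (HVariety E) k <-> variety_type (rho_star E) k.
Proof.
move=> lf k; split; apply: variety_type_imp.
- exact: same_types_of_V.
- exact: same_types_of_W.
- move=> A /(same_types_of_W lf) [L [Lfp LA]].
  by exists L; split=> //; apply: same_types_sym.
- move=> L /(same_types_of_V lf) [A [Afp LA]].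
  by exists A; split=> //; apply: same_types_sym.
Qed.
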